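(* Let $(M,\pi)$ be a Poisson manifold, let $c$ be a Casimir function for $\pi$, and let $\lambda\in\mathbb{R}$. For each Poisson vector field $X$ on $M$, with complete lift $X_C$ and vertical lift $X_V$ to $TM$, $$\pi_{TM,X_C,X_V,c}=\pi_{TM}+\lambda\, c(\mathbf{x})\,X_C\wedge X_V$$ is a Poisson tensor on $TM$.
   Context: All manifolds, functions and tensors are smooth. A bivector field $P$ is a Poisson tensor if the bracket $\{f,g\}=P(df,dg)$ satisfies the Jacobi identity (equivalently, the Schouten--Nijenhuis bracket $[P,P]$ vanishes). On a Poisson manifold $(M,\pi)$ with $\{f,g\}=\pi(df,dg)$, a Casimir function is a $c\in C^\infty(M)$ with $\{\cdot,c\}=0$, and a Poisson vector field is a vector field $X$ with $\mathcal{L}_X\pi=0$. Local coordinates $\mathbf{x}=(x^1,\dots,x^N)$ on $M$ induce coordinates $(\mathbf{x},\mathbf{y})=(x^1,\dots,x^N,y^1,\dots,y^N)$ on $TM$, where $y^i$ is the fiber-wise linear function defined by $dx^i$. With $\pi^{ij}=\{x^i,x^j\}$, the Poisson tensor on $TM$ induced by $\pi$ is $$\pi_{TM}(\mathbf{x},\mathbf{y})=\sum_{i,j} \pi^{ij}(\mathbf{x})\frac{\partial}{\partial x^i}\wedge \frac{\partial}{\partial y^j}+\frac12\sum_{i,j,s}\frac{\partial\pi^{ij}}{\partial x^s}(\mathbf{x})\,y^s\frac{\partial}{\partial y^i}\wedge \frac{\partial}{\partial y^j}.$$ For $X=\sum_i v^i(\mathbf{x})\frac{\partial}{\partial x^i}$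 the complete and vertical lifts are the vector fields on $TM$ given by $X_{C}=\sum_{i} v^i(\mathbf{x})\frac{\partial}{\partial x^i}+\sum_{i,s} \frac{\partial v^i}{\partial x^s}(\mathbf{x})\,y^s\frac{\partial}{\partial y^i}$ and $X_{V}=\sum_{i} v^i(\mathbf{x})\frac{\partial}{\partial y^i}$. The factor $c(\mathbf{x})$ on $TM$ means $c\circ q_M$, with $q_M:TM\to M$ the projection. *)

(* Defs.v *)
From HB Require Import structures.
From mathcomp Require Import all_boot all_order all_algebra.
From mathcomp Require Import all_classical all_reals all_analysis.

Set Implicit Arguments.
Unset Strict Implicit.
Unset Printing Implicit Defensive.

Import Order.TTheory GRing.Theory Num.Theory.
Import numFieldNormedType.Exports.

Local Open Scope classical_set_scope.
Local Open Scope ring_scope.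

Section EuclideanSmoothness.
Context {R : realType} {n : nat}.

Definition partial (i : 'I_n) (f : 'rV[R]_n -> R) : 'rV[R]_n -> R :=
  'D_(delta_mx 0 i) f.

Fixpoint Ck (k : nat) (V : set 'rV[R]_n) (f : 'rV[R]_n -> R) : Prop :=
  match k with
  | 0 => forall x, V x -> {for x, continuous f}
  | k'.+1 => (forall x, V x -> differentiable f x) /\
             (forall i, Ck k' V (partial i f))
  end.

(* Only used for V open: the values of f outside V then play no role. *)
Definition smooth_on (V : set 'rV[R]_n) (f : 'rV[R]_n -> R) : Prop :=
  forall k, Ck k V f.

(* The bivector u /\ v as the matrix of its components
   (u /\ v)(dx^i, dx^j) = u^i v^j - v^i u^j. *)
Definition wedge (u v : 'rV[R]_n) : 'M[R]_n := u^T *m v - v^T *m u.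

End EuclideanSmoothness.

(* A chart is a subset chart_dom a of T with coordinates coord a on it; param a
   is the inverse of coord a on the image of chart_dom a, and is junk outside.
   chart_at p is a preferred chart around p. *)
Record atlas (R : realType) (n : nat) (T : Type) := Atlas {
  chart_ix : Type;
  chart_dom : chart_ix -> set T;
  coord : chart_ix -> T -> 'rV[R]_n;
  param : chart_ix -> 'rV[R]_n -> T;
  chart_at : T -> chart_ix
}.

Section Tensors.
Context {R : realType} {n : nat} {T : Type} (A : atlas R n T).
Implicit Types a b : chart_ix A.

Definition chart_image a : set 'rV[R]_n := coord a @` chart_dom a.

Definition transition a b : 'rV[R]_n -> 'rV[R]_n := coord b \o param a.

Definition overlap a b : set 'rV[R]_n :=
  coord a @` (chart_dom a `&` chart_dom b).

Definition smooth_function (f : T -> R) : Prop :=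
  forall a, smooth_on (chart_image a) (f \o param a).

(* Tensor fields are given by their components in each chart, as functions of
   the coordinates; the values outside chart_image a are junk. Tangent vectors
   are row vectors, so they are transformed by 'J on the right, where
   ('J f x) i j is the derivative of f^j along x^i. *)
Definition vector_comp := chart_ix A -> 'rV[R]_n -> 'rV[R]_n.
Definition bivector_comp := chart_ix A -> 'rV[R]_n -> 'M[R]_n.

Record vector_field (X : vector_comp) : Prop := VectorField {
  vector_smooth : forall a j, smooth_on (chart_image a) (fun x => X a x 0 j);
  vector_compat : forall a b x, overlap a b x ->
    X b (transition a b x) = X a x *m 'J (transition a b) x
}.

Record bivector_field (P : bivector_comp) : Prop := BivectorField {
  bivector_smooth : forall a i j,
    smooth_on (chart_image a) (fun x => P a x i j);
  bivector_skew : forall a x, chart_image a x -> (P a x)^T = - P a x;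
  bivector_compat : forall a b x, overlap a b x ->
    P b (transition a b x)
      = ('J (transition a b) x)^T *m P a x *m 'J (transition a b) x
}.

(* P(df, dg); for a bivector field the value does not depend on the chart. *)
Definition bracket (P : bivector_comp) (f g : T -> R) (p : T) : R :=
  let a := chart_at A p in
  let x := coord a p in
  \sum_i \sum_j P a x i j * partial i (f \o param a) x
                          * partial j (g \o param a) x.

Definition poisson_tensor (P : bivector_comp) : Prop :=
  bivector_field P /\
  forall f g h : T -> R,
    smooth_function f -> smooth_function g -> smooth_function h ->
    forall p, bracket P f (bracket P g h) p + bracket P g (bracket P h f) p
              + bracket P h (bracket P f g) p = 0.

Definition casimir (P : bivector_comp) (c : T -> R) : Prop :=
  smooth_function c /\
  forall f, smooth_function f -> forall p, bracket P f c p = 0.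

Definition lie_derivative (X : vector_comp) (P : bivector_comp) :
    bivector_comp := fun a x =>
  \matrix_(i, j) \sum_s
    (X a x 0 s * partial s (fun u => P a u i j) x
     - P a x s j * partial s (fun u => X a u 0 i) x
     - P a x i s * partial s (fun u => X a u 0 j) x).

Definition poisson_vector_field (P : bivector_comp) (X : vector_comp) : Prop :=
  vector_field X /\
  forall a x, chart_image a x -> lie_derivative X P a x = 0.

End Tensors.

Record smooth_manifold (R : realType) (n : nat) (M : topologicalType)
    (A : atlas R n M) : Prop := SmoothManifold {
  manifold_hausdorff : hausdorff_space M;
  manifold_second_countable : @second_countable M;
  chart_at_dom : forall p, chart_dom (chart_at A p) p;
  chart_dom_open : forall a : chart_ix A, open (chart_dom a);
  chart_image_open : forall a : chart_ix A, open (chart_image a);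
  coordK : forall (a : chart_ix A) p, chart_dom a p -> param a (coord a p) = p;
  coord_continuous : forall a : chart_ix A,
    {within chart_dom a, continuous (coord a)};
  param_continuous : forall a : chart_ix A,
    {within chart_image a, continuous (param a)};
  transition_smooth : forall (a b : chart_ix A) j,
    smooth_on (overlap a b) (fun x => transition a b x 0 j)
}.

(* The tangent space at p is identified with R^n through the chart chart_at p:
   (p, v) is the tangent vector at p whose components in that chart are v.
   Hence the identification, but not the carrier type, depends on A. *)
Definition tangent_bundle (R : realType) (n : nat) (M : Type)
  (A : atlas R n M) : Type := (M * 'rV[R]_n)%type.

Definition tangent_proj (R : realType) (n : nat) (M : Type) (A : atlas R n M)
  (w : tangent_bundle A) : M := w.1.

Section TangentBundle.
Context {R : realType} {n : nat} {M : Type} (A : atlas R n M).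

(* The components dx^i(w) of a tangent vector w in the chart a. *)
Definition tangent_comp (a : chart_ix A) (w : tangent_bundle A) : 'rV[R]_n :=
  let b := chart_at A (tangent_proj w) in
  w.2 *m 'J (transition b a) (coord b (tangent_proj w)).

Definition tangent_vector (a : chart_ix A) (x y : 'rV[R]_n) :
    tangent_bundle A :=
  let p := param a x in (p, y *m 'J (transition a (chart_at A p)) x).

(* The charts (x, y) of the tangent bundle induced by the charts x of M. *)
Definition tangent_atlas : atlas R (n + n) (tangent_bundle A) :=
  {| chart_ix := chart_ix A;
     chart_dom := fun a => @tangent_proj _ _ _ A @^-1` chart_dom a;
     coord := fun a w => row_mx (coord a (tangent_proj w)) (tangent_comp a w);
     param := fun a z => tangent_vector a (lsubmx z) (rsubmx z);
     chart_at := fun w => chart_at A (tangent_proj w) |}.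

(* The coordinate vector fields d/dx^i and d/dy^i. *)
Definition ddx (i : 'I_n) : 'rV[R]_(n + n) := row_mx (delta_mx 0 i) 0.
Definition ddy (i : 'I_n) : 'rV[R]_(n + n) := row_mx 0 (delta_mx 0 i).

Definition tangent_poisson (P : bivector_comp A) :
    bivector_comp tangent_atlas := fun a z =>
  let x := lsubmx z in let y := rsubmx z in
  \sum_i \sum_j P a x i j *: wedge (ddx i) (ddy j)
  + 2^-1 *: \sum_i \sum_j \sum_s
      (partial s (fun u => P a u i j) x * y 0 s) *: wedge (ddy i) (ddy j).

Definition complete_lift (X : vector_comp A) : vector_comp tangent_atlas :=
  fun a z =>
  let x := lsubmx z in let y := rsubmx z in
  \sum_i X a x 0 i *: ddx i
  + \sum_i \sum_s (partial s (fun u => X a u 0 i) x * y 0 s) *: ddy i.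

Definition vertical_lift (X : vector_comp A) : vector_comp tangent_atlas :=
  fun a z => \sum_i X a (lsubmx z) 0 i *: ddy i.

End TangentBundle.

(* Main.v *)
Require Import Defs.
From HB Require Import structures.
From mathcomp Require Import all_boot all_order all_algebra.
From mathcomp Require Import all_classical all_reals all_analysis.
From mathcomp Require Import ring lra.

(** In coordinates [(x, y)] on the tangent bundle the tensor is the block matrix
    with zero upper left block, off-diagonal blocks [P + mu v^T v] and
    [P - mu v^T v], and lower right block [P' + mu (v'^T v - v^T v')]. Here [P], [v]
    are the components of the Poisson tensor and of [X], [mu] is [lambda * c], and
    the prime is the complete lift [clift], the derivative along the fibre
    coordinate [y].

    The transformation law is the Leibniz rule for the prime: a transition map
    [phi] of the base induces [(x, y) |-> (phi x, y *m 'J phi)], whose Jacobian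
    matrix has diagonal blocks ['J phi] and off-diagonal block [('J phi)'] by the
    symmetry of second derivatives ([partialC], [tangent_jacobian]).

    The Jacobi identity is equivalent to the vanishing of the components
    [jacobiator] of the Schouten square. On the tangent bundle they are computed
    from three facts about the base: the Jacobiator of [P] vanishes, the Lie
    derivative of [P] along [v] vanishes, and [P dmu = 0]. Components with at most
    one fibre index vanish because the base coordinates Poisson commute and the
    off-diagonal blocks do not depend on [y]. With two fibre indices
    ([jacobiator_lifted_lrr]) the component is a combination of the three facts,
    and with three ([jacobiator_lifted_rrr]) of these facts and the primes of the
    first two. In both cases the terms quadratic in [mu] cancel.

    The hypotheses on [P] and [c], unlike that on [X], speak of global smooth
    functions. Passing to components at a point needs smooth functions on the
    manifold with prescribed differential there ([test_function]); they are made
    from [exp (- 1/t)], and extending them by 0 uses that the manifold is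
    Hausdorff. The converse passage, from components to brackets of arbitrary
    functions, is [poisson_of_jacobiator]: brackets do not depend on the chart
    ([bracket_in_chart]), and second derivatives of the functions cancel in the
    cyclic sum ([coord_jacobi]). *)

Set Implicit Arguments.
Unset Strict Implicit.
Unset Printing Implicit Defensive.

Import Order.TTheory GRing.Theory Num.Theory.
Import numFieldNormedType.Exports.
Import Defs.

Local Open Scope classical_set_scope.
Local Open Scope ring_scope.

(** * Partial derivatives and Jacobian matrices *)

Section Differentiation.
Context {R : realType}.

Lemma near_on (T : topologicalType) (V : set T) (P : T -> Prop) x :
  open V -> V x -> (forall u, V u -> P u) -> \near x, P x.
Proof. by move=> oV Vx VP; exact: (filterS VP (open_nbhs_nbhs (conj oV Vx))). Qed.

Lemma differentiable_rV (V : normedModType R) n (f : V -> 'rV[R]_n) x :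
  (forall j, differentiable (fun u => f u 0 j) x) -> differentiable f x.
Proof.
move=> df.
have -> : f = \sum_(j < n) (fun u => f u 0 j *: (delta_mx 0 j : 'rV[R]_n)).
  by apply/funext => u; rewrite fct_sumE [LHS]row_sum_delta.
by apply: differentiable_sum => j; apply: differentiableZl.
Qed.

Lemma continuous_rV (V : normedModType R) n (f : V -> 'rV[R]_n) x :
  (forall j, {for x, continuous (fun u => f u 0 j)}) -> {for x, continuous f}.
Proof.
move=> cf.
have -> : f = \sum_(j < n) (fun u => f u 0 j *: (delta_mx 0 j : 'rV[R]_n)).
  by apply/funext => u; rewrite fct_sumE [LHS]row_sum_delta.
elim/big_ind : _ => [|g h cg ch|j _]; first exact: cst_continuous.
  exact: cvgD cg ch.
exact: cvgZr_tmp (cf j).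
Qed.

Lemma differentiable_entry (V : normedModType R) n (f : V -> 'rV[R]_n) x j :
  differentiable f x -> differentiable (fun u => f u 0 j) x.
Proof.
move=> df; apply: (@differentiable_comp _ _ _ _ f (fun u => u 0 j)) => //.
exact: differentiable_coord.
Qed.

Lemma derive_entry (V : normedModType R) n (f : V -> 'rV[R]_n) x v j :
  differentiable f x -> ('D_v f x) 0 j = 'D_v (fun u => f u 0 j) x.
Proof.
move=> df; have dv : derivable f x v by exact: diff_derivable.
have := @derive_mx R V 1 n f x v dv.
by move=> /matrixP /(_ 0 j); rewrite mxE.
Qed.

Lemma jacobianE m n (f : 'rV[R]_m -> 'rV[R]_n) x i j :
  differentiable f x -> ('J f x) i j = partial i (fun u => f u 0 j) x.
Proof.
move=> df; have /matrixP /(_ 0 j) := deriveEjacobian (delta_mx 0 i) df.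
by rewrite -rowE mxE => <-; rewrite derive_entry.
Qed.

Lemma derive_partial n (f : 'rV[R]_n -> R) x v : differentiable f x ->
  'D_v f x = \sum_s v 0 s * partial s f x.
Proof.
move=> df; rewrite deriveE // {1}[v]row_sum_delta linear_sum /=.
by apply: eq_bigr => s _; rewrite linearZ /= /partial deriveE.
Qed.

Lemma partial_comp m n (f : 'rV[R]_n -> R) (g : 'rV[R]_m -> 'rV[R]_n) x i :
  differentiable g x -> differentiable f (g x) ->
  partial i (f \o g) x
  = \sum_j partial j f (g x) * partial i (fun u => g u 0 j) x.
Proof.
move=> dg df; rewrite /partial deriveE; last exact: differentiable_comp.
rewrite diff_comp //= -deriveE // -deriveE // derive_partial //.
by apply: eq_bigr => j _; rewrite derive_entry // mulrC.
Qed.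

Lemma jacobian_comp l m n (f : 'rV[R]_m -> 'rV[R]_n) (g : 'rV[R]_l -> 'rV[R]_m)
    x : differentiable g x -> differentiable f (g x) ->
  'J (f \o g) x = 'J g x *m 'J f (g x).
Proof.
move=> dg df; apply/matrixP => i j; rewrite jacobianE; last first.
  exact: differentiable_comp.
rewrite (@partial_comp _ _ (fun u => f u 0 j)) //; last first.
  exact: differentiable_entry.
by rewrite mxE; apply: eq_bigr => k _; rewrite !jacobianE // mulrC.
Qed.

Lemma partialD n i (f g : 'rV[R]_n -> R) x :
  differentiable f x -> differentiable g x ->
  partial i (fun u => f u + g u) x = partial i f x + partial i g x.
Proof. by move=> df dg; rewrite /partial deriveD //; exact: diff_derivable. Qed.

Lemma partialM n i (f g : 'rV[R]_n -> R) x :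
  differentiable f x -> differentiable g x ->
  partial i (fun u => f u * g u) x
  = partial i f x * g x + f x * partial i g x.
Proof.
move=> df dg; rewrite /partial (@deriveM _ _ f g); try exact: diff_derivable.
by rewrite addrC mulrC.
Qed.

Lemma partial_sum n m i (f : 'I_m -> 'rV[R]_n -> R) x :
  (forall k, differentiable (f k) x) ->
  partial i (fun u => \sum_k f k u) x = \sum_k partial i (f k) x.
Proof.
move=> df; rewrite /partial -derive_sum; last first.
  by move=> k; exact: diff_derivable.
by congr ('D__ _ _); apply/funext => u; rewrite fct_sumE.
Qed.

Lemma partial_cst n i (a : R) (x : 'rV[R]_n) : partial i (fun=> a) x = 0.
Proof. exact: derive_cst. Qed.

Lemma partial_entry n (i j : 'I_n) (x : 'rV[R]_n) :
  partial i (fun u => u 0 j) x = (i == j)%:R.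
Proof.
have did : differentiable (id : 'rV[R]_n -> 'rV[R]_n) x by [].
apply: etrans (esym (derive_entry (delta_mx 0 i) j did)) _.
by rewrite derive_id mxE eqxx eq_sym.
Qed.

Lemma partial_near n i (f g : 'rV[R]_n -> R) x :
  (\near x, f x = g x) -> partial i f x = partial i g x.
Proof. exact: near_eq_derive. Qed.

Lemma partial_eq_on n i (V : set 'rV[R]_n) (f g : 'rV[R]_n -> R) x :
  open V -> V x -> (forall u, V u -> f u = g u) -> partial i f x = partial i g x.
Proof.
by move=> oV Vx fg; apply: partial_near; exact: near_on oV Vx fg.
Qed.

(** The differential is selected by a choice operator, so that its locality is not
    immediate: [g] is [f] plus a function that vanishes near [x], and such a
    function has differential 0. *)
Lemma differentiable_near (V W : normedModType R) (f g : V -> W) x :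
  (\near x, f x = g x) -> differentiable f x -> differentiable g x.
Proof.
move=> fg df; rewrite -[g](subrK f); apply: differentiableD => //.
have c0 : continuous (\0 : {linear V -> W}) by exact: cst_continuous.
have h0 : (g - f) \o shift x = cst ((g - f) x) + (\0 : {linear V -> W}) +o_ 0 id.
  have -> : (g - f) x = 0 by rewrite -[LHS]/(g x - f x) -(nbhs_singleton fg) subrr.
  apply: eqaddoE; apply/eqaddoP => e e0.
  have := fg; rewrite (near_shift 0) subr0 /= => fg0.
  near=> y; rewrite -[X in `|X|]/(g (y + x) - f (y + x) - (0 + 0)) addr0 subr0.
  have -> : f (y + x) = g (y + x) by near: y.
  by rewrite subrr normr0 mulr_ge0 // ltW.
apply/diff_locallyP; rewrite (diff_unique c0 h0).
by split.
Unshelve. all: by end_near. Qed.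

End Differentiation.

(** * Smooth functions on open sets *)

Section SmoothCalculus.
Context {R : realType}.

Lemma Ck_eq_on n k (V : set 'rV[R]_n) f g :
  open V -> (forall u, V u -> f u = g u) -> Ck k V f -> Ck k V g.
Proof.
move=> oV; elim: k f g => [|k IH] f g fg /=.
  move=> cf x Vx; have nfg : \near x, f x = g x by exact: near_on oV Vx fg.
  rewrite /prop_for /continuous_at -(fg _ Vx).
  have cfx : f u @[u --> x] --> f x by exact: cf.
  exact: cvg_trans (near_eq_cvg nfg) cfx.
move=> [df cf]; split.
  move=> x Vx; apply: differentiable_near (df x Vx).
  exact: near_on oV Vx fg.
move=> i; apply: IH (cf i) => x Vx; exact: partial_eq_on Vx fg.
Qed.

Lemma CkS n k (V : set 'rV[R]_n) f : Ck k.+1 V f -> Ck k V f.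
Proof.
elim: k f => [|k IH] f [df cf].
  by move=> x Vx; apply: differentiable_continuous; exact: df.
by split => // i; apply: IH.
Qed.

(** [Ck k V f] constrains [f] and its partial derivatives only at the points of
    [V]. *)
Lemma CkU n k (V W : set 'rV[R]_n) f :
  Ck k V f -> Ck k W f -> Ck k (V `|` W) f.
Proof.
elim: k f => [|k IH] f /=; first by move=> cV cW x [/cV|/cW].
by move=> [dV cV] [dW cW]; split => [x [/dV|/dW] //|i]; apply: IH.
Qed.

Lemma CkD n k (V : set 'rV[R]_n) f g : open V ->
  Ck k V f -> Ck k V g -> Ck k V (fun u => f u + g u).
Proof.
move=> oV; elim: k f g => [|k IH] f g.
  by move=> cf cg x Vx; exact: cvgD (cf x Vx) (cg x Vx).
move=> [df cf] [dg cg]; split => [x Vx|i].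
  by apply: differentiableD; [exact: df|exact: dg].
apply: (@Ck_eq_on _ _ _ (fun u => partial i f u + partial i g u)) => //.
  by move=> u Vu; rewrite partialD //; [exact: df|exact: dg].
exact: (IH _ _ (cf i) (cg i)).
Qed.

Lemma CkM n k (V : set 'rV[R]_n) f g : open V ->
  Ck k V f -> Ck k V g -> Ck k V (fun u => f u * g u).
Proof.
move=> oV; elim: k f g => [|k IH] f g.
  by move=> cf cg x Vx; exact: cvgM (cf x Vx) (cg x Vx).
move=> cf cg; have [df cf'] := cf; have [dg cg'] := cg; split => [x Vx|i].
  by apply: differentiableM; [exact: df|exact: dg].
apply: (@Ck_eq_on _ _ _ (fun u => partial i f u * g u + f u * partial i g u)).
- exact: oV.
- by move=> u Vu; rewrite partialM //; [exact: df|exact: dg].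
- apply: CkD => //; first exact: (IH _ _ (cf' i) (CkS cg)).
  exact: (IH _ _ (CkS cf) (cg' i)).
Qed.

Lemma Ck_cst n k (V : set 'rV[R]_n) (a : R) : Ck k V (fun=> a).
Proof.
elim: k a => [|k IH] a; first by move=> x _; exact: cst_continuous.
split => [x _|i]; first exact: differentiable_cst.
suff -> : partial i (fun=> a) = fun=> 0 :> R by [].
by apply/funext => x; rewrite partial_cst.
Qed.

Lemma Ck_sum n k m (V : set 'rV[R]_n) (f : 'I_m -> 'rV[R]_n -> R) : open V ->
  (forall i, Ck k V (f i)) -> Ck k V (fun u => \sum_i f i u).
Proof.
move=> oV; elim: m f => [|m IH] f cf.
  have -> : (fun u => \sum_i f i u) = fun=> 0 by
    apply/funext => u; rewrite big_ord0.
  exact: Ck_cst.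
have -> : (fun u => \sum_i f i u)
    = fun u => \sum_(i < m) f (widen_ord (leqnSn m) i) u + f ord_max u.
  by apply/funext => u; rewrite big_ord_recr.
apply: CkD => //; exact: (IH (fun i => f (widen_ord (leqnSn m) i))).
Qed.

Lemma Ck_entry n k (V : set 'rV[R]_n) j : Ck k V (fun u => u 0 j).
Proof.
case: k => [|k].
  by move=> x _; apply: differentiable_continuous; exact: differentiable_coord.
split => [x _|i]; first exact: differentiable_coord.
have -> : partial i (fun u : 'rV[R]_n => u 0 j) = fun=> (i == j)%:R.
  by apply/funext => x; rewrite partial_entry.
exact: Ck_cst.
Qed.

(** By the chain rule, a partial derivative of [f \o g] is a sum of products of
    functions [partial j f \o g] and partial derivatives of [g]; this allows an
    induction on [k] for all [f] at once. *)
Lemma Ck_comp m n k (V : set 'rV[R]_m) (W : set 'rV[R]_n) f g : open V ->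
  (forall x, V x -> W (g x)) -> (forall j, Ck k V (fun u => g u 0 j)) ->
  Ck k W f -> Ck k V (f \o g).
Proof.
move=> oV VW; elim: k f => [|k IH] f cg.
  move=> cf x Vx; apply: continuous_comp; last exact/cf/VW.
  exact: (continuous_rV (fun j => cg j x Vx)).
move=> [df cf]; have dg x : V x -> differentiable g x.
  by move=> Vx; apply: differentiable_rV => j; exact: (cg j).1.
split=> [x Vx|i].
  by apply: differentiable_comp; [exact: dg|exact/df/VW].
apply: (@Ck_eq_on _ _ _ (fun x =>
  \sum_j partial j f (g x) * partial i (fun u => g u 0 j) x)) => //.
  by move=> u Vu; rewrite partial_comp //; [exact: dg|exact/df/VW].
apply: Ck_sum => // j; apply: CkM => //; last exact: (cg j).2.
exact: (IH (partial j f) (fun j' => CkS (cg j')) (cf j)).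
Qed.

Lemma smooth_differentiable n (V : set 'rV[R]_n) f x :
  smooth_on V f -> V x -> differentiable f x.
Proof. by move=> /(_ 1%N) [df _] /df. Qed.

Lemma smooth_partial n (V : set 'rV[R]_n) f i :
  smooth_on V f -> smooth_on V (partial i f).
Proof. by move=> sf k; exact: (sf k.+1).2. Qed.

Lemma smooth_eq_on n (V : set 'rV[R]_n) f g : open V ->
  (forall u, V u -> f u = g u) -> smooth_on V f -> smooth_on V g.
Proof. by move=> oV fg sf k; exact: Ck_eq_on fg (sf k). Qed.

Lemma smoothU n (V W : set 'rV[R]_n) f :
  smooth_on V f -> smooth_on W f -> smooth_on (V `|` W) f.
Proof. by move=> sV sW k; apply: CkU. Qed.

Lemma smoothD n (V : set 'rV[R]_n) f g : open V ->
  smooth_on V f -> smooth_on V g -> smooth_on V (fun u => f u + g u).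
Proof. by move=> oV sf sg k; apply: CkD. Qed.

Lemma smoothM n (V : set 'rV[R]_n) f g : open V ->
  smooth_on V f -> smooth_on V g -> smooth_on V (fun u => f u * g u).
Proof. by move=> oV sf sg k; apply: CkM. Qed.

Lemma smooth_cst n (V : set 'rV[R]_n) (a : R) : smooth_on V (fun=> a).
Proof. by move=> k; exact: Ck_cst. Qed.

Lemma smoothN n (V : set 'rV[R]_n) f : open V ->
  smooth_on V f -> smooth_on V (fun u => - f u).
Proof.
move=> oV sf; apply: (@smooth_eq_on _ _ (fun u => -1 * f u)) => //.
  by move=> u _; rewrite mulN1r.
by apply: smoothM => //; exact: smooth_cst.
Qed.

Lemma smooth_sum n m (V : set 'rV[R]_n) (f : 'I_m -> 'rV[R]_n -> R) : open V ->
  (forall i, smooth_on V (f i)) -> smooth_on V (fun u => \sum_i f i u).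
Proof. by move=> oV sf k; apply: Ck_sum => // i; exact: sf. Qed.

Lemma smooth_entry n (V : set 'rV[R]_n) j : smooth_on V (fun u => u 0 j).
Proof. by move=> k; exact: Ck_entry. Qed.

Lemma smooth_comp m n (V : set 'rV[R]_m) (W : set 'rV[R]_n) f g : open V ->
  (forall x, V x -> W (g x)) -> (forall j, smooth_on V (fun u => g u 0 j)) ->
  smooth_on W f -> smooth_on V (f \o g).
Proof. by move=> oV VW sg sf k; apply: (Ck_comp oV VW) => // j; exact: sg. Qed.

End SmoothCalculus.

(** * Symmetry of second partial derivatives *)

Section MixedPartials.
Context {R : realType} {n : nat}.
Local Notation ev k := (delta_mx 0 k : 'rV[R]_n).
Implicit Types (f : 'rV[R]_n -> R) (V : set 'rV[R]_n).

Lemma is_derive_line f y v s : differentiable f (y + s *: v) ->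
  is_derive s (1 : R) (fun r => f (y + r *: v)) ('D_v f (y + s *: v)).
Proof.
move=> df; have dv : derivable f (y + s *: v) v by exact: diff_derivable.
have E : (fun h : R => h^-1 *: (((fun r => f (y + r *: v)) \o shift s) (h *: 1)
            - f (y + s *: v)))
       = (fun h => h^-1 *: ((f \o shift (y + s *: v)) (h *: v)
            - f (y + s *: v))).
  apply/funext => h /=; congr (_ *: (f _ - _)).
  by rewrite scaler1 scalerDl addrCA.
by split; rewrite /derivable /derive ?E.
Qed.

Lemma derive_translate f w a v :
  'D_v (fun u => f (u + w)) a = 'D_v f (a + w).
Proof.
have E : (fun h : R => h^-1 *: (((fun u => f (u + w)) \o shift a) (h *: v)
            - f (a + w)))
       = (fun h => h^-1 *: ((f \o shift (a + w)) (h *: v) - f (a + w))).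
  by apply/funext => h /=; rewrite addrA.
by rewrite /derive E.
Qed.

Lemma mean_value_line f y v t : 0 < t ->
  (forall s, 0 <= s <= t -> differentiable f (y + s *: v)) ->
  exists2 s, 0 <= s <= t & f (y + t *: v) - f y = t * 'D_v f (y + s *: v).
Proof.
move=> t0 df.
have dr s : s \in `]0, t[ ->
    is_derive s (1 : R) (fun r => f (y + r *: v)) ('D_v f (y + s *: v)).
  by rewrite in_itv /= => /andP[s0 st]; apply/is_derive_line/df; rewrite !ltW.
have [|s] := MVT t0 dr.
  apply: derivable_within_continuous => s; rewrite in_itv /= => st.
  by have [] := is_derive_line (df s st).
rewrite in_itv /= => /andP[s0 st] E; exists s; first by rewrite !ltW.
by move: E; rewrite scale0r addr0 subr0 mulrC.
Qed.

(** Mean value theorem along [ev i] for [u |-> f (u + t *: ev j) - f u], then along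
    [ev j] for [partial i f]. The left-hand side is symmetric in [i] and [j]. *)
Lemma second_difference f x i j t : 0 < t ->
  (forall s r, 0 <= s <= t -> 0 <= r <= t ->
     differentiable f (x + s *: ev i + r *: ev j) /\
     differentiable (partial i f) (x + s *: ev i + r *: ev j)) ->
  exists s r, [/\ 0 <= s <= t, 0 <= r <= t &
    f (x + t *: ev i + t *: ev j) - f (x + t *: ev i) - f (x + t *: ev j) + f x
    = t * (t * partial j (partial i f) (x + s *: ev i + r *: ev j))].
Proof.
move=> t0 df; have tt : 0 <= t <= t by apply/andP; split; [exact: ltW|exact: lexx].
have t00 : 0 <= (0 : R) <= t by apply/andP; split; [exact: lexx|exact: ltW].
pose g u := f (u + t *: ev j) - f u.
have dsh s : 0 <= s <= t ->
    differentiable (fun u => f (u + t *: ev j)) (x + s *: ev i).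
  move=> hs; apply: (@differentiable_comp _ _ _ _ (fun u => u + t *: ev j) f).
    by apply: differentiableD => //; exact: differentiable_cst.
  by have [] := df s t hs tt.
have d0 s : 0 <= s <= t -> differentiable f (x + s *: ev i).
  by move=> hs; have [] := df s 0 hs t00; rewrite scale0r addr0.
have dg s : 0 <= s <= t -> differentiable g (x + s *: ev i).
  by move=> hs; apply: differentiableB; [exact: dsh|exact: d0].
have [s hs E] := mean_value_line t0 dg.
have Dg : 'D_(ev i) g (x + s *: ev i)
    = partial i f (x + s *: ev i + t *: ev j) - partial i f (x + s *: ev i).
  rewrite (@deriveB _ _ _ (fun u => f (u + t *: ev j)) f); first last.
  - exact/diff_derivable/d0.
  - exact/diff_derivable/dsh.
  by rewrite derive_translate.
have dpf r : 0 <= r <= t -> differentiable (partial i f) (x + s *: ev i + r *: ev j).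
  by move=> hr; have [] := df s r hs hr.
have [r hr E'] := mean_value_line t0 dpf.
exists s, r; split => //.
by rewrite /partial -E' -/(partial _ _) -Dg -E /g; ring.
Qed.

(** Divided by [t ^+ 2], the second difference of [f] is a value, near [x], of
    either mixed derivative; both are continuous at [x]. *)
Lemma partialC V f i j x : open V -> smooth_on V f -> V x ->
  partial i (partial j f) x = partial j (partial i f) x.
Proof.
move=> oV sf Vx.
have cont k l : partial k (partial l f) u @[u --> x] --> partial k (partial l f) x.
  exact: (smooth_partial k (smooth_partial l sf) 0%N x Vx).
have key e : 0 < e ->
    `|partial i (partial j f) x - partial j (partial i f) x| <= e.
  move=> e0; have e20 : 0 < e / 2 by rewrite divr_gt0.
  have /cvgrPdist_lt /(_ _ e20) nij := cont i j.
  have /cvgrPdist_lt /(_ _ e20) nji := cont j i.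
  have nV : \near x, V x by exact: (open_nbhs_nbhs (conj oV Vx)).
  have : \forall u \near x, [/\ V u,
      `|partial i (partial j f) x - partial i (partial j f) u| < e / 2 &
      `|partial j (partial i f) x - partial j (partial i f) u| < e / 2].
    exact: (filterS3 _ (fun u a b c => And3 a b c) nV nij nji).
  move=> /nbhs_ballP[r /= r0 br].
  (* x + s e_k + q e_l stays in the ball of radius r when s and q are at most t. *)
  pose t := r / 3; have t0 : 0 < t by rewrite divr_gt0.
  have inb k l s q : 0 <= s <= t -> 0 <= q <= t ->
      ball x r (x + s *: ev k + q *: ev l).
    move=> /andP[s0 st] /andP[q0 qt].
    rewrite -ball_normE /ball_ /= -addrA opprD addrA subrr add0r normrN.
    apply: (le_lt_trans (ler_normD _ _)); rewrite !normrZ !ger0_norm //.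
    have nd (m : 'I_n) : `|ev m| <= 1.
      rewrite [leLHS]mx_normrE; apply: bigmax_le => // -[a b] _.
      by rewrite mxE /=; case: (_ && _); rewrite ?normr1 ?normr0.
    have h1 : s * `|ev k| <= t.
      by rewrite -[leRHS]mulr1 ler_pM.
    have h2 : q * `|ev l| <= t.
      by rewrite -[leRHS]mulr1 ler_pM.
    by apply: (le_lt_trans (lerD h1 h2)); rewrite /t; lra.
  have dd k l s q : 0 <= s <= t -> 0 <= q <= t ->
      let y := x + s *: ev k + q *: ev l in
      differentiable f y /\ differentiable (partial k f) y.
    move=> hs hq y; have [Vy _ _] := br _ (inb k l s q hs hq).
    split; first exact: smooth_differentiable sf Vy.
    exact: smooth_differentiable (smooth_partial k sf) Vy.
  have [s1 [q1 [hs1 hq1 E1]]] := second_difference t0 (dd i j).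
  have [s2 [q2 [hs2 hq2 E2]]] := second_difference t0 (dd j i).
  have [_ _ b1] := br _ (inb i j s1 q1 hs1 hq1).
  have [_ b2 _] := br _ (inb j i s2 q2 hs2 hq2).
  have E : partial j (partial i f) (x + s1 *: ev i + q1 *: ev j)
      = partial i (partial j f) (x + s2 *: ev j + q2 *: ev i).
    apply: (mulfI (lt0r_neq0 t0)); apply: (mulfI (lt0r_neq0 t0)).
    apply: (etrans (esym E1)).
    apply: etrans E2.
    have -> : x + t *: ev j + t *: ev i = x + t *: ev i + t *: ev j.
      by rewrite addrAC.
    by congr (_ + _); exact: addrAC.
  rewrite E in b1; move: b1 b2.
  set a := partial i _ x; set b := partial j _ x; set c := partial i _ _.
  move: a b c => a b c b1 b2; have := ler_distD c a b; rewrite (distrC c b).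
  clear -b1 b2; lra.
apply/eqP; rewrite -subr_eq0 -normr_eq0 eq_le normr_ge0 andbT.
by apply/ler_addgt0Pl => e e0; rewrite addr0 key.
Qed.

End MixedPartials.

(** * Smooth functions that are flat at the origin *)

Section FlatFunction.
Context {R : realType}.

(** The functions [t^-k * exp (- 1/t)], for all [k] together: their span is closed
    under differentiation, so that smoothness becomes an induction. *)
Definition flat (k : nat) (t : R) : R :=
  if 0 < t then t^-1 ^+ k * expR (- t^-1) else 0.

Lemma flat_gt0 k t : 0 < t -> 0 < flat k t.
Proof. by move=> t0; rewrite /flat t0 mulr_gt0 ?exprn_gt0 ?invr_gt0 ?expR_gt0. Qed.

Lemma flat_le0 k t : t <= 0 -> flat k t = 0.
Proof. by rewrite /flat ltNge => ->. Qed.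

(** With [s = 1/t], this is [s ^+ k.+1 / k.+1`! <= expR s]. *)
Lemma flat_bound k t : `|flat k t| <= (k.+1)`!%:R * `|t|.
Proof.
case: (ltP 0 t) => t0; last by rewrite flat_le0 // normr0 mulr_ge0.
rewrite (gtr0_norm (flat_gt0 k t0)) (gtr0_norm t0) /flat t0 expRN.
have s0 : 0 < t^-1 by rewrite invr_gt0.
have := expR_ge1Dxn k (ltW s0); rewrite -{5}[t]invrK; move: (t^-1) s0 => s s0 E.
have f0 : 0 < (k.+1)`!%:R :> R by rewrite ltr0n fact_gt0.
have {}E : s ^+ k.+1 / (k.+1)`!%:R <= expR s.
  by apply: le_trans E; rewrite lerDr.
rewrite ler_pdivlMr // mulrAC -exprSr ler_pdivrMr ?expR_gt0 //.
by rewrite mulrC -ler_pdivrMr.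
Qed.

(** At 0 the difference quotient of [flat k] is [flat k.+1], which tends to 0 by
    [flat_bound]. *)
Lemma is_derive_flat k t :
  is_derive t (1 : R) (flat k) (flat k.+2 t - k%:R * flat k.+1 t).
Proof.
case: (ltgtP t 0) => [t0|t0|->].
- rewrite !flat_le0 ?(ltW t0) // mulr0 subr0.
  have nf : \near t, cst 0 t = flat k t.
    apply: filterS (lt_nbhsl t0) => u /ltW u0; by rewrite flat_le0.
  exact: (near_eq_is_derive nf (is_derive_cst _ _ _)).
- rewrite /flat t0.
  have nf : \near t, t^-1 ^+ k * expR (- t^-1) = flat k t.
    apply: filterS (lt_nbhsr t0) => u u0; by rewrite /flat u0.
  apply: (near_eq_is_derive nf).
  have tn0 : t != 0 by rewrite gt_eqF.
  have di : is_derive t (1 : R) (fun u : R => u^-1) (- t^-2).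
    split; first exact: (@derivableV _ _ id).
    by rewrite (@deriveV _ _ id) // derive_id; rewrite /= scaler1.
  have dm : is_derive t (1 : R) (fun u : R => - u^-1) (t^-2).
    by have := is_deriveN di; rewrite opprK.
  have de : is_derive t (1 : R) (expR \o (fun u : R => - u^-1)) (expR (- t^-1) * t^-2).
    exact: is_derive1_comp.
  have dp := is_deriveX k di.
  have dM := is_deriveM dp de.
  have -> : (fun t => t^-1 ^+ k * expR (- t^-1))
      = ((fun u => u^-1) ^+ k) * (expR \o (fun u : R => - u^-1)).
    by apply/funext => u; rewrite !fctE.
  apply: (is_derive_eq dM); rewrite /GRing.scale /= !fctE.
  case: k {nf dp dM} => [|k]; first by rewrite expr0 mul0r; field.
  by rewrite -pred_Sn !exprS; move: (t^-1 ^+ k) => z; field.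
- rewrite !flat_le0 // mulr0 subr0.
  have L : (fun h : R => h^-1 *: ((flat k \o shift 0) (h *: 1) - flat k 0))
      @ 0^' --> (0 : R).
    apply/cvgrPdist_le => e e0; near=> h.
    rewrite /= addr0 scaler1 (flat_le0 k (lexx 0)) subr0 sub0r normrN.
    have h0 : h != 0 by near: h; exact: nbhs_dnbhs_neq.
    have -> : h^-1 *: flat k h = flat k.+1 h.
      rewrite /flat; case: ifP => _; last by rewrite scaler0.
      by rewrite exprS -mulrA.
    apply: (le_trans (flat_bound _ _)).
    rewrite -ler_pdivlMl ?ltr0n ?fact_gt0 //.
    near: h; apply: dnbhs0_le.
    by rewrite mulr_gt0 // invr_gt0 ltr0n fact_gt0.
  split; first by apply/cvg_ex; exists 0.
  exact: cvg_lim L.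
Unshelve. all: by end_near. Qed.

Lemma Ck_flat n m (V : set 'rV[R]_n) k g : open V ->
  Ck m V g -> Ck m V (flat k \o g).
Proof.
move=> oV; elim: m k => [|m IH] k.
  move=> cg x Vx; apply: continuous_comp; first exact: cg.
  by apply/differentiable_continuous/derivable1_diffP; have [] := is_derive_flat k (g x).
move=> cg; have [dg cg'] := cg.
have df t : differentiable (flat k) t.
  by apply/derivable1_diffP; have [] := is_derive_flat k t.
split => [x Vx|i]; first by apply: differentiable_comp => //; exact: dg.
apply: (@Ck_eq_on _ _ _ _ (fun u =>
  (flat k.+2 (g u) + (- k%:R) * flat k.+1 (g u)) * partial i g u)) => //.
  move=> u Vu; have dgu := dg u Vu.
  rewrite /partial [RHS]deriveE; last exact: differentiable_comp.
  rewrite [in RHS]diff_comp //= -(deriveE _ dgu).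
  have E (a : R) : 'd (flat k) (g u) a = a * 'D_1 (flat k) (g u).
    rewrite deriveE // -[RHS]/(a *: _) -linearZ /=; congr ('d _ _ _).
    by rewrite -[LHS]mulr1.
  rewrite E (@derive_val _ _ _ _ _ _ _ (is_derive_flat k (g u))).
  by rewrite mulNr mulrC.
apply: CkM => //; last exact: cg'.
apply: CkD => //; first exact: (IH k.+2 (CkS cg)).
apply: CkM => //; first exact: Ck_cst.
exact: (IH k.+1 (CkS cg)).
Qed.

End FlatFunction.

(** * Cutting off a coordinate function *)

Section LocalizedCoordinate.
Context {R : realType} {n : nat}.

(** The coordinate [u i - x0 i] times a cutoff function [flat 0 (r^2 - |u - x0|^2)].
    The cutoff need not be constant near [x0]: at [x0] its derivative is multiplied
    by [x0 i - x0 i], so that one normalizing factor suffices. *)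
Lemma localized_coordinate (x0 : 'rV[R]_n) r i : 0 < r ->
  exists psi : 'rV[R]_n -> R, [/\ smooth_on setT psi,
    forall u, ~ ball x0 r u -> psi u = 0 &
    forall j, partial j psi x0 = (j == i)%:R].
Proof.
move=> r0; pose d (u : 'rV[R]_n) := r ^+ 2 + - \sum_j (u 0 j + - x0 0 j) * (u 0 j + - x0 0 j).
pose a := flat 0 (r ^+ 2).
have a0 : a != 0 by rewrite gt_eqF // flat_gt0 // exprn_gt0.
have oT : open [set: 'rV[R]_n] by exact: openT.
have sl j : smooth_on setT (fun u : 'rV[R]_n => u 0 j + - x0 0 j).
  by apply: smoothD => //; [exact: smooth_entry|exact: smooth_cst].
have sd : smooth_on setT d.
  apply: smoothD => //; first exact: smooth_cst.
  apply: smoothN => //; apply: smooth_sum => // j; exact: smoothM.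
have sf : smooth_on setT (flat 0 \o d) by move=> k; apply: Ck_flat.
have dx0 : d x0 = r ^+ 2.
  by rewrite /d big1 ?oppr0 ?addr0 // => j _; rewrite subrr mulr0.
exists (fun u => a^-1 * (flat 0 (d u) * (u 0 i + - x0 0 i))); split.
- by apply: smoothM => //; [exact: smooth_cst|exact: smoothM].
- move=> u nu; rewrite flat_le0 ?mul0r ?mulr0 // leNgt; apply/negP => du.
  apply: nu; rewrite -ball_normE /ball_ /=.
  rewrite [ltLHS]mx_normrE; apply/bigmax_ltP; split => // -[k j] _ /=.
  rewrite (ord1 k) !mxE -(ltr_pXn2r (ltn0Sn 1)) ?nnegrE ?(ltW r0) //.
  rewrite real_normK ?num_real //; move: du; rewrite /d subr_gt0.
  apply: le_lt_trans; rewrite (bigD1 j) //= -[leLHS]addr0 lerD //.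
    by rewrite -sqrrN opprB expr2.
  by apply: sumr_ge0 => l _; rewrite -expr2 sqr_ge0.
- move=> j; have D g : smooth_on setT g -> differentiable g x0.
    by move=> sg; exact: smooth_differentiable sg _.
  rewrite partialM; [|exact: D (@smooth_cst _ _ _ _)|exact/D/smoothM].
  rewrite partialM; [|exact: D|exact: D].
  rewrite partial_cst mul0r add0r subrr mulr0 add0r /= dx0 -/a mulKf //.
  rewrite partialD; [|exact: D (@smooth_entry _ _ _ _)|exact: D (@smooth_cst _ _ _ _)].
  by rewrite partial_cst addr0 partial_entry.
Qed.

End LocalizedCoordinate.

(** * Smooth atlases *)

Section SmoothAtlas.
Context (R : realType) (n : nat) (T : Type).

(** What [smooth_manifold] says about the charts, without a topology on [T]: the
    tangent bundle is a product type whose product topology is not the right one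
    when the preferred charts jump. *)
Record smooth_atlas (A : atlas R n T) : Prop := SmoothAtlas {
  atlas_chart_at : forall p, chart_dom (chart_at A p) p;
  atlas_image_open : forall a : chart_ix A, open (chart_image a);
  atlas_overlap_open : forall a b : chart_ix A, open (overlap a b);
  atlas_coordK :
    forall (a : chart_ix A) p, chart_dom a p -> param a (coord a p) = p;
  atlas_transition_smooth : forall (a b : chart_ix A) j,
    smooth_on (overlap a b) (fun x => transition a b x 0 j)
}.

End SmoothAtlas.

Arguments atlas_image_open {R n T A} _ a.
Arguments atlas_overlap_open {R n T A} _ a b.

Section AtlasTensors.
Context {R : realType} {n : nat} {T : Type}.
Context (A : atlas R n T) (atlas_A : smooth_atlas A).
Implicit Types a b c : chart_ix A.

Lemma chart_image_coord a p : chart_dom a p -> chart_image a (coord a p).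
Proof. by exists p. Qed.

Lemma chart_dom_param a x : chart_image a x -> chart_dom a (param a x).
Proof. by move=> [p ap <-]; rewrite (atlas_coordK atlas_A). Qed.

Lemma paramK a x : chart_image a x -> coord a (param a x) = x.
Proof. by move=> [p ap <-]; rewrite (atlas_coordK atlas_A). Qed.

Lemma overlapP a b x :
  overlap a b x <-> chart_image a x /\ chart_dom b (param a x).
Proof.
split=> [[p [ap bp] <-]|[ax bx]].
  by rewrite (atlas_coordK atlas_A) //; split => //; exists p.
by exists (param a x); [split => //; exact: chart_dom_param|exact: paramK].
Qed.

Lemma transitionE a b x : transition a b x = coord b (param a x).
Proof. by []. Qed.

Lemma overlap_image a b x : overlap a b x -> chart_image a x.
Proof. by move=> /overlapP []. Qed.

Lemma param_transition a b x :
  overlap a b x -> param b (transition a b x) = param a x.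
Proof. by move=> /overlapP [_ bx]; rewrite transitionE (atlas_coordK atlas_A). Qed.

Lemma transition_coord a b p :
  chart_dom a p -> transition a b (coord a p) = coord b p.
Proof. by move=> ap; rewrite transitionE (atlas_coordK atlas_A). Qed.

Lemma overlap_transition a b x :
  overlap a b x -> overlap b a (transition a b x).
Proof.
move=> /[dup] abx /overlapP [ax bx]; apply/overlapP; split.
  exact: chart_image_coord.
by rewrite param_transition //; exact: chart_dom_param.
Qed.

Lemma transition_differentiable a b x :
  overlap a b x -> differentiable (transition a b) x.
Proof.
move=> abx; apply: differentiable_rV => j.
exact: smooth_differentiable (atlas_transition_smooth atlas_A a b j) abx.
Qed.

Lemma transition_cocycle a b c x : overlap a b x ->
  transition b c (transition a b x) = transition a c x.
Proof. by move=> abx; rewrite transitionE param_transition. Qed.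

Lemma jacobian_eq_on m (f g : 'rV[R]_n -> 'rV[R]_m) V x : open V -> V x ->
  (forall u, V u -> f u = g u) -> differentiable f x -> 'J f x = 'J g x.
Proof.
move=> oV Vx fg df; have dg : differentiable g x.
  by apply: differentiable_near df; exact: near_on oV Vx fg.
apply/matrixP => i j; apply: (etrans (jacobianE i j df)).
apply: (etrans _ (esym (jacobianE i j dg))).
by apply: (partial_eq_on _ oV Vx) => u Vu; rewrite fg.
Qed.

(** The chain rule on the triple overlap, which is open. *)
Lemma jacobian_cocycle a b c x : overlap a b x -> overlap a c x ->
  'J (transition a b) x *m 'J (transition b c) (transition a b x)
  = 'J (transition a c) x.
Proof.
move=> abx acx.
have bcx : overlap b c (transition a b x).
  apply/overlapP; split; first exact/overlap_image/overlap_transition.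
  by rewrite param_transition //; have /overlapP [] := acx.
rewrite -jacobian_comp; [|exact: transition_differentiable..].
apply: (@jacobian_eq_on _ _ _ (overlap a b `&` overlap a c)).
- by apply: openI; exact: (atlas_overlap_open atlas_A).
- by [].
- by move=> u [abu acu]; exact: transition_cocycle.
- by apply: differentiable_comp; exact: transition_differentiable.
Qed.

Lemma jacobian_id (x : 'rV[R]_n) : 'J (id : 'rV[R]_n -> 'rV[R]_n) x = 1%:M.
Proof.
by apply/matrixP => i j; rewrite jacobianE // partial_entry mxE.
Qed.

Lemma overlapxx a x : chart_image a x -> overlap a a x.
Proof. by move=> ax; apply/overlapP; split => //; exact: chart_dom_param. Qed.

Lemma jacobian_transitionxx a x :
  chart_image a x -> 'J (transition a a) x = 1%:M.
Proof.
move=> ax; rewrite -(jacobian_id x).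
apply: (@jacobian_eq_on _ _ _ (chart_image a)) => //.
- exact: (atlas_image_open atlas_A).
- by move=> u au; rewrite transitionE paramK.
- exact/transition_differentiable/overlapxx.
Qed.

Lemma jacobian_transitionK a b x : overlap a b x ->
  'J (transition a b) x *m 'J (transition b a) (transition a b x) = 1%:M.
Proof.
move=> abx; have ax := overlap_image abx.
by rewrite jacobian_cocycle ?jacobian_transitionxx //; exact: overlapxx.
Qed.

(** * Brackets and the Jacobiator in a chart *)

Definition grad (f : 'rV[R]_n -> R) x : 'cV[R]_n := \col_i partial i f x.

Lemma grad_comp (f : 'rV[R]_n -> R) (g : 'rV[R]_n -> 'rV[R]_n) x :
  differentiable g x -> differentiable f (g x) ->
  grad (f \o g) x = 'J g x *m grad f (g x).
Proof.
move=> dg df; apply/matrixP => i j; rewrite !mxE partial_comp //.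
by apply: eq_bigr => k _; rewrite jacobianE // mxE mulrC.
Qed.

Definition coord_bracket (P : 'rV[R]_n -> 'M[R]_n) (f g : 'rV[R]_n -> R) x : R :=
  \sum_i \sum_j P x i j * partial i f x * partial j g x.

Lemma coord_bracketE P f g x :
  coord_bracket P f g x = ((grad f x)^T *m P x *m grad g x) 0 0.
Proof.
rewrite /coord_bracket exchange_big mxE; apply: eq_bigr => j _ /=.
rewrite !mxE mulr_suml; apply: eq_bigr => i _.
by rewrite !mxE [P x i j * _]mulrC.
Qed.

Lemma coord_bracket_eq P f g g' x :
  (forall j, partial j g x = partial j g' x) ->
  coord_bracket P f g x = coord_bracket P f g' x.
Proof. by move=> E; do 2![apply: eq_bigr => ? _]; rewrite E. Qed.

Lemma smooth_function_differentiable (f : T -> R) a x :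
  smooth_function A f -> chart_image a x -> differentiable (f \o param a) x.
Proof. by move=> sf ax; exact: smooth_differentiable (sf a) ax. Qed.

Lemma grad_transition (f : T -> R) a b x :
  smooth_function A f -> overlap a b x ->
  grad (f \o param a) x
  = 'J (transition a b) x *m grad (f \o param b) (transition a b x).
Proof.
move=> sf abx; rewrite -grad_comp; last 2 first.
- exact: transition_differentiable.
- apply: smooth_function_differentiable => //.
  exact/overlap_image/overlap_transition.
apply/matrixP => i j; rewrite !mxE.
have oab := atlas_overlap_open atlas_A a b.
apply: (partial_eq_on _ oab abx) => u abu.
by rewrite /= param_transition.
Qed.

(** Differentials transform by the Jacobian matrix and [P] by its transpose, and
    the two cancel in the matrix product [grad f ^T *m P *m grad g]. Without this,
    a bracket could not be differentiated: its definition changes charts from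
    point to point. *)
Lemma bracket_in_chart (P : bivector_comp A) (f g : T -> R) a p :
  bivector_field P -> smooth_function A f -> smooth_function A g ->
  chart_dom a p ->
  bracket P f g p
  = coord_bracket (P a) (f \o param a) (g \o param a) (coord a p).
Proof.
move=> bP sf sg ap; rewrite /bracket -/(coord_bracket _ _ _ _).
set b := chart_at A p; have bp : chart_dom b p := atlas_chart_at atlas_A p.
have abx : overlap a b (coord a p).
  by apply/overlapP; split; [exact: chart_image_coord|rewrite (atlas_coordK atlas_A)].
rewrite -(transition_coord b ap) !coord_bracketE.
rewrite (grad_transition sf abx) (grad_transition sg abx).
by rewrite (bivector_compat bP abx) trmx_mul !mulmxA.
Qed.

Lemma smooth_coord_bracket (P : 'rV[R]_n -> 'M[R]_n) f g V : open V ->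
  (forall i j, smooth_on V (fun u => P u i j)) ->
  smooth_on V f -> smooth_on V g -> smooth_on V (coord_bracket P f g).
Proof.
move=> oV sP sf sg.
do 2![apply: smooth_sum => // ?].
by do ?apply: smoothM => //; exact: smooth_partial.
Qed.

Lemma bracket_param (P : bivector_comp A) (f g : T -> R) a :
  bivector_field P -> smooth_function A f -> smooth_function A g ->
  forall u, chart_image a u -> (bracket P f g \o param a) u
  = coord_bracket (P a) (f \o param a) (g \o param a) u.
Proof.
move=> bP sf sg u au; rewrite /= (bracket_in_chart bP sf sg (chart_dom_param au)).
by rewrite paramK.
Qed.

Lemma bracket_smooth (P : bivector_comp A) (f g : T -> R) :
  bivector_field P -> smooth_function A f -> smooth_function A g ->
  smooth_function A (bracket P f g).
Proof.
move=> bP sf sg a; have oa := atlas_image_open atlas_A a.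
apply: (@smooth_eq_on _ _ _ (coord_bracket (P a) (f \o param a) (g \o param a))).
- exact: oa.
- by move=> u au; rewrite bracket_param.
- by apply: smooth_coord_bracket => //; exact: (bivector_smooth bP).
Qed.

(** The components of half the Schouten bracket [[P, P]], up to sign. *)
Definition jacobiator (P : 'rV[R]_n -> 'M[R]_n) x i j k : R :=
  \sum_s (P x i s * partial s (fun u => P u j k) x
          + P x j s * partial s (fun u => P u k i) x
          + P x k s * partial s (fun u => P u i j) x).

(** The components of the vector field [P (df, -)]. *)
Let hamiltonian (P : 'rV[R]_n -> 'M[R]_n) f x s : R :=
  \sum_i partial i f x * P x i s.

Let hessian f x (u v : 'I_n -> R) : R :=
  \sum_s \sum_j u s * v j * partial s (partial j f) x.

Lemma hessianC f V x u v : open V -> smooth_on V f -> V x ->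
  hessian f x u v = hessian f x v u.
Proof.
move=> oV sf Vx; rewrite /hessian exchange_big /=.
apply: eq_bigr => s _; apply: eq_bigr => j _.
by rewrite (partialC s j oV sf Vx) [u j * _]mulrC.
Qed.

(** The part of the nested bracket in which the derivative falls on [P]. *)
Let tensor_term (P : 'rV[R]_n -> 'M[R]_n) f g h x : R :=
  \sum_i \sum_j \sum_k partial i f x * partial j g x * partial k h x *
    (\sum_s P x i s * partial s (fun u => P u j k) x).

(** In the other two terms the derivative falls on [g] or on [h]; by skew-symmetry
    of [P] these are values of Hessians on Hamiltonian fields, with opposite signs. *)
Lemma coord_bracket_nested (P : 'rV[R]_n -> 'M[R]_n) f g h V x :
  open V -> V x -> (forall i j, smooth_on V (fun u => P u i j)) ->
  (P x)^T = - P x ->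
  smooth_on V f -> smooth_on V g -> smooth_on V h ->
  coord_bracket P f (coord_bracket P g h) x
  = tensor_term P f g h x
    - hessian g x (hamiltonian P f x) (hamiltonian P h x)
    + hessian h x (hamiltonian P f x) (hamiltonian P g x).
Proof.
move=> oV Vx sP skP sf sg sh.
have dP i j := smooth_differentiable (sP i j) Vx.
have dg j := smooth_differentiable (smooth_partial j sg) Vx.
have dh j := smooth_differentiable (smooth_partial j sh) Vx.
have D s : partial s (coord_bracket P g h) x
    = \sum_j \sum_k (partial s (fun u => P u j k) x * partial j g x * partial k h x
        + P x j k * partial s (partial j g) x * partial k h x
        + P x j k * partial j g x * partial s (partial k h) x).
  rewrite partial_sum => [|j]; last first.
    have sj : smooth_on V (fun u => \sum_k P u j k * partial j g u * partial k h u).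
      apply: smooth_sum => // k.
      by do ?apply: smoothM => //; exact: smooth_partial.
    exact: smooth_differentiable sj Vx.
  apply: eq_bigr => j _; rewrite partial_sum => [|k]; last first.
    by apply: differentiableM => //; exact: differentiableM.
  apply: eq_bigr => k _; rewrite partialM //; last exact: differentiableM.
  by rewrite partialM // mulrDl.
have E : coord_bracket P f (coord_bracket P g h) x
    = \sum_s hamiltonian P f x s * partial s (coord_bracket P g h) x.
  rewrite /coord_bracket exchange_big /=; apply: eq_bigr => s _.
  by rewrite mulr_suml; apply: eq_bigr => i _; rewrite [P x i s * _]mulrC.
rewrite E.
have hk j : \sum_k P x j k * partial k h x = - hamiltonian P h x j.
  rewrite /hamiltonian -sumrN; apply: eq_bigr => k _.
  have /matrixP /(_ k j) := skP; rewrite !mxE => ->.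
  by rewrite mulNr mulrC.
have Ds s : partial s (coord_bracket P g h) x
    = (\sum_j \sum_k partial s (fun u => P u j k) x * partial j g x * partial k h x)
      - (\sum_j hamiltonian P h x j * partial s (partial j g) x)
      + (\sum_k hamiltonian P g x k * partial s (partial k h) x).
  rewrite D.
  under eq_bigr do rewrite !big_split /=.
  rewrite !big_split /=; congr (_ + _ + _).
    rewrite -sumrN; apply: eq_bigr => j _; rewrite -mulNr -hk mulr_suml.
    by apply: eq_bigr => k _; rewrite mulrAC.
  rewrite exchange_big /=; apply: eq_bigr => k _; rewrite mulr_suml.
  by apply: eq_bigr => j _; rewrite [P x j k * _]mulrC.
under eq_bigr do rewrite Ds mulrDr mulrBr.
rewrite !big_split /= sumrN; congr (_ - _ + _); last first.
- by apply: eq_bigr => s _; rewrite mulr_sumr; apply: eq_bigr => k _; rewrite mulrA.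
- by apply: eq_bigr => s _; rewrite mulr_sumr; apply: eq_bigr => k _; rewrite mulrA.
transitivity (\sum_s \sum_i \sum_j \sum_k
    partial i f x * partial j g x * partial k h x
    * (P x i s * partial s (fun u => P u j k) x)).
  apply: eq_bigr => s _; rewrite mulr_suml; apply: eq_bigr => i _.
  rewrite mulr_sumr; apply: eq_bigr => j _.
  by rewrite mulr_sumr; apply: eq_bigr => k _; ring.
rewrite exchange_big; apply: eq_bigr => i _ /=.
rewrite exchange_big; apply: eq_bigr => j _ /=.
rewrite exchange_big; apply: eq_bigr => k _ /=.
by rewrite mulr_sumr.
Qed.

Lemma sum3_rot (F : 'I_n -> 'I_n -> 'I_n -> R) :
  \sum_i \sum_j \sum_k F i j k = \sum_i \sum_j \sum_k F j k i.
Proof.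
rewrite [RHS]exchange_big /=; apply: eq_bigr => i _; exact: exchange_big.
Qed.

(** In the cyclic sum each Hessian occurs twice, with its two arguments exchanged
    and opposite signs, so that only first derivatives of [f], [g], [h] survive.
    This tensoriality is what makes test functions with prescribed differentials
    sufficient later on. *)
Lemma coord_jacobi (P : 'rV[R]_n -> 'M[R]_n) f g h V x :
  open V -> V x -> (forall i j, smooth_on V (fun u => P u i j)) ->
  (P x)^T = - P x ->
  smooth_on V f -> smooth_on V g -> smooth_on V h ->
  coord_bracket P f (coord_bracket P g h) x
  + coord_bracket P g (coord_bracket P h f) x
  + coord_bracket P h (coord_bracket P f g) x
  = \sum_i \sum_j \sum_k jacobiator P x i j k
      * (partial i f x * partial j g x * partial k h x).
Proof.
move=> oV Vx sP skP sf sg sh.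
rewrite !(coord_bracket_nested oV Vx sP skP) //.
rewrite (hessianC (hamiltonian P g x) (hamiltonian P f x) oV sh Vx).
rewrite (hessianC (hamiltonian P g x) (hamiltonian P h x) oV sf Vx).
rewrite (hessianC (hamiltonian P h x) (hamiltonian P f x) oV sg Vx).
transitivity (tensor_term P f g h x + tensor_term P g h f x
              + tensor_term P h f g x).
  move: (hessian f _ _ _) (hessian g _ _ _) (hessian h _ _ _) => hf hg hh.
  move: (tensor_term _ f _ _ _) (tensor_term _ g _ _ _) => tf tg.
  by move: (tensor_term _ h _ _ _) => th; ring.
rewrite /tensor_term [X in _ + X + _]sum3_rot.
rewrite [X in _ + _ + X]sum3_rot [X in _ + _ + X]sum3_rot.
rewrite -!big_split; apply: eq_bigr => i _ /=.
rewrite -!big_split; apply: eq_bigr => j _ /=.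
rewrite -!big_split; apply: eq_bigr => k _ /=.
rewrite /jacobiator !big_split /=.
move: (partial i f x) (partial j g x) (partial k h x) => fi gj hk.
move: (\sum_s P x i s * _) (\sum_s P x j s * _) (\sum_s P x k s * _) => si sj sk.
ring.
Qed.

Lemma jacobi_in_chart (P : bivector_comp A) (f g h : T -> R) a p :
  bivector_field P -> smooth_function A f -> smooth_function A g ->
  smooth_function A h -> chart_dom a p ->
  bracket P f (bracket P g h) p + bracket P g (bracket P h f) p
    + bracket P h (bracket P f g) p
  = \sum_i \sum_j \sum_k jacobiator (P a) (coord a p) i j k
      * (partial i (f \o param a) (coord a p)
         * partial j (g \o param a) (coord a p)
         * partial k (h \o param a) (coord a p)).
Proof.
move=> bP sf sg sh ap; have ax := chart_image_coord ap.
have oa := atlas_image_open atlas_A a.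
have nested u v w : smooth_function A u -> smooth_function A v ->
    smooth_function A w -> bracket P u (bracket P v w) p
    = coord_bracket (P a) (u \o param a)
        (coord_bracket (P a) (v \o param a) (w \o param a)) (coord a p).
  move=> su sv sw; rewrite (bracket_in_chart bP su (bracket_smooth bP sv sw) ap).
  apply: coord_bracket_eq => j.
  exact: (partial_eq_on _ oa ax (bracket_param bP sv sw)).
rewrite !nested //; apply: (coord_jacobi oa ax).
- exact: (bivector_smooth bP).
- exact: (bivector_skew bP ax).
- exact: sf.
- exact: sg.
- exact: sh.
Qed.

Lemma poisson_of_jacobiator (P : bivector_comp A) : bivector_field P ->
  (forall a x, chart_image a x -> forall i j k, jacobiator (P a) x i j k = 0) ->
  poisson_tensor P.
Proof.
move=> bP JP; split => // f g h sf sg sh p.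
have ap := atlas_chart_at atlas_A p.
rewrite (jacobi_in_chart bP sf sg sh ap) big1 // => i _; rewrite big1 // => j _.
by rewrite big1 // => k _; rewrite JP ?mul0r //; exact: chart_image_coord.
Qed.

End AtlasTensors.

(** * From global identities to identities of components *)

Section Manifold.
Context {R : realType} {n : nat} {M : topologicalType}.
Context (A : atlas R n M) (manifold_M : smooth_manifold A).
Implicit Types a b : chart_ix A.

Lemma param_preimage_open a (U : set M) : open U ->
  open (chart_image a `&` param a @^-1` U).
Proof.
move=> oU; have oa := chart_image_open manifold_M (a := a).
apply: (continuous_inP _ oa).1 oU.
by rewrite -continuous_open_subspace //; exact: (param_continuous manifold_M (a := a)).
Qed.

Lemma manifold_atlas : smooth_atlas A.
Proof.
split.
- exact: (chart_at_dom manifold_M).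
- exact: (chart_image_open manifold_M).
- move=> a b; rewrite (_ : overlap a b = chart_image a `&` param a @^-1` chart_dom b).
    exact/param_preimage_open/(chart_dom_open manifold_M).
  apply/seteqP; split=> x.
    by move=> [p [ap bp] <-]; split; [exists p|rewrite /= (coordK manifold_M)].
  move=> [[p ap <-]] /=; rewrite (coordK manifold_M) // => bp.
  by exists p.
- exact: (coordK manifold_M).
- exact: (transition_smooth manifold_M).
Qed.

(** A localized coordinate extended by 0. It is smooth because its support lies in
    the image of a closed ball, which is compact, hence closed since [M] is
    Hausdorff: [M] is covered by the chart domain and by the complement of that
    image. *)
Lemma test_function a p i : chart_dom a p ->
  exists2 f : M -> R, smooth_function A f &
    forall j, partial j (f \o param a) (coord a p) = (j == i)%:R.
Proof.
move=> ap; have sA := manifold_atlas.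
have ax := chart_image_coord ap.
have oa := atlas_image_open sA a.
have [r /= r0 br] : exists2 r, 0 < r & closed_ball (coord a p) r `<=` chart_image a.
  have /nbhs_closedballP [r rb] : nbhs (coord a p) (chart_image a).
    exact: open_nbhs_nbhs.
  by exists r%:num.
have [psi [spsi psi0 dpsi]] := localized_coordinate (coord a p) i r0.
pose K := param a @` closed_ball (coord a p) r.
have cK : closed K.
  apply: compact_closed; first exact: (manifold_hausdorff manifold_M).
  apply: continuous_compact.
    apply: continuous_subspaceW br _.
    exact: (param_continuous manifold_M (a := a)).
  apply: bounded_closed_compact; last exact: closed_ball_closed.
  exists (`|coord a p| + r); split; first exact: num_real.
  move=> y ry u; rewrite closed_ballE // /closed_ball_ /= => ur.
  apply: le_trans (ltW ry); rewrite -[u in leLHS](subKr (coord a p)).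
  by apply: (le_trans (ler_normB _ _)); rewrite lerD2l.
pose f q := if `[< chart_dom a q >] then psi (coord a q) else 0.
have fE u : chart_image a u -> f (param a u) = psi u.
  move=> au; rewrite /f; case: asboolP => [_|[]]; first by rewrite (paramK sA).
  exact: (chart_dom_param sA).
exists f; last first.
  by move=> j; rewrite -dpsi; apply: (partial_eq_on _ oa ax).
move=> b; have ob := atlas_image_open sA b.
have oab := atlas_overlap_open sA b a.
pose W := chart_image b `&` param b @^-1` (~` K).
have oW : open W by apply: param_preimage_open; exact: closed_openC.
have -> : chart_image b = overlap b a `|` W.
  apply/seteqP; split=> u; last first.
    by move=> [/(overlap_image sA)//|[]].
  move=> bu; have [au|nau] := pselect (chart_dom a (param b u)).
    by left; apply/(overlapP sA).
  right; split => // -[v /br av E]; apply: nau; rewrite -E.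
  exact: (chart_dom_param sA).
(* On the first set f is psi in other coordinates, on the second it vanishes. *)
apply: smoothU.
  apply: (@smooth_eq_on _ _ _ (psi \o transition b a)) => //.
    move=> u bau; rewrite /= -(param_transition sA bau) fE //.
    exact/(overlap_image sA)/(overlap_transition sA).
  apply: (smooth_comp oab _ _ spsi) => // j.
  exact: (atlas_transition_smooth sA).
apply: (@smooth_eq_on _ _ _ (fun=> 0)) => //; last exact: smooth_cst.
move=> u [bu nK]; rewrite /= /f; case: asboolP => // au.
apply/esym/psi0 => bu'; apply: nK; exists (coord a (param b u)).
  exact: subset_closed_ball bu'.
exact: (atlas_coordK sA).
Qed.

Lemma sum3_delta (F : 'I_n -> 'I_n -> 'I_n -> R) i j k :
  \sum_i' \sum_j' \sum_k'
    F i' j' k' * ((i' == i)%:R * (j' == j)%:R * (k' == k)%:R) = F i j k.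
Proof.
rewrite (bigD1 i) //= (bigD1 j) //= (bigD1 k) //= !eqxx !mulr1.
rewrite big1 ?addr0 => [|k' /negPf ->]; last by rewrite !mulr0.
rewrite big1 ?addr0 => [|j' /negPf nj]; last first.
  by rewrite big1 // => k' _; rewrite nj mulr0 mul0r mulr0.
rewrite big1 ?addr0 // => i' /negPf ni.
by do 2!rewrite big1 // => ? _; rewrite ni !mul0r mulr0.
Qed.

(** The Jacobi identity for three test functions whose differentials at the point
    are [dx^i], [dx^j], [dx^k]. *)
Lemma jacobiator_eq0 (P : bivector_comp A) : poisson_tensor P ->
  forall a x, chart_image a x -> forall i j k, jacobiator (P a) x i j k = 0.
Proof.
move=> [bP JP] a x ax i j k; have sA := manifold_atlas.
have ap := chart_dom_param sA ax.
have [f sf df] := test_function i ap.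
have [g sg dg] := test_function j ap.
have [h sh dh] := test_function k ap.
have := jacobi_in_chart sA bP sf sg sh ap.
rewrite JP // (paramK sA ax) in df dg dh * => E; rewrite [RHS]E.
transitivity (\sum_i' \sum_j' \sum_k' jacobiator (P a) x i' j' k'
    * ((i' == i)%:R * (j' == j)%:R * (k' == k)%:R)); last first.
  by do 3!apply: eq_bigr => ? _; rewrite df dg dh.
by rewrite sum3_delta.
Qed.

Lemma casimir_in_chart (P : bivector_comp A) (c : M -> R) :
  bivector_field P -> casimir P c ->
  forall a x, chart_image a x -> forall i,
    \sum_s P a x i s * partial s (c \o param a) x = 0.
Proof.
move=> bP [sc Pc] a x ax i; have sA := manifold_atlas.
have ap := chart_dom_param sA ax; have [f sf df] := test_function i ap.
have := Pc f sf (param a x); rewrite (bracket_in_chart sA bP sf sc ap).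
rewrite (paramK sA ax) in df * => E; rewrite -[RHS]E.
rewrite /coord_bracket [RHS](bigD1 i) //= [X in _ = _ + X]big1 ?addr0 => [|i' /negPf ni].
  by apply: eq_bigr => s _; rewrite df eqxx mulr1.
by rewrite big1 // => s _; rewrite df ni mulr0 mul0r.
Qed.

End Manifold.

(** * Complete lifts of functions and of matrices of functions *)

Section CompleteLift.
Context {R : realType} {n : nat}.
Implicit Types (f g : 'rV[R]_n -> R) (V : set 'rV[R]_n) (z : 'rV[R]_(n + n)).

(** The complete lift of [f]: its differential seen as a function on the tangent
    bundle, or the derivative of [f] along the fibre coordinate. Over the
    projection it is a derivation, and its partial derivatives along the base and
    the fibre are [clift (partial i f)] and [partial i f]. *)
Definition clift f z : R :=
  \sum_s partial s f (lsubmx z) * rsubmx z 0 s.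

Definition tube V : set 'rV[R]_(n + n) := lsubmx @^-1` V.

Lemma tube_open V : open V -> open (tube V).
Proof. by move=> oV; apply: open_comp oV => z _; exact: continuous_lsubmx. Qed.

Lemma lsubmx_entry z j : lsubmx z 0 j = z 0 (lshift n j).
Proof. by rewrite mxE. Qed.

Lemma rsubmx_entry z j : rsubmx z 0 j = z 0 (rshift n j).
Proof. by rewrite mxE. Qed.

Lemma partial_pullback f z k : differentiable f (lsubmx z) ->
  partial k (f \o lsubmx) z
  = \sum_j partial j f (lsubmx z) * (k == lshift n j)%:R.
Proof.
move=> df; rewrite partial_comp //; last exact: differentiable_lsubmx.
apply: eq_bigr => j _; congr (_ * _).
have -> : (fun u : 'rV[R]_(n + n) => lsubmx u 0 j) = fun u => u 0 (lshift n j).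
  by apply/funext => u; rewrite lsubmx_entry.
exact: partial_entry.
Qed.

Lemma partial_pullback_l f z i : differentiable f (lsubmx z) ->
  partial (lshift n i) (f \o lsubmx) z = partial i f (lsubmx z).
Proof.
move=> df; rewrite partial_pullback // (bigD1 i) //= eqxx mulr1.
rewrite big1 ?addr0 // => j /negPf ji.
by rewrite eq_lshift eq_sym ji mulr0.
Qed.

Lemma partial_pullback_r f z i : differentiable f (lsubmx z) ->
  partial (rshift n i) (f \o lsubmx) z = 0.
Proof.
move=> df; rewrite partial_pullback // big1 // => j _.
by rewrite eq_rlshift mulr0.
Qed.

Lemma smooth_pullback f V : open V -> smooth_on V f ->
  smooth_on (tube V) (f \o lsubmx).
Proof.
move=> oV sf; apply: (smooth_comp (tube_open oV) _ _ sf) => // j.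
have -> : (fun u : 'rV[R]_(n + n) => lsubmx u 0 j) = fun u => u 0 (lshift n j).
  by apply/funext => u; rewrite lsubmx_entry.
exact: smooth_entry.
Qed.

Lemma smooth_rsubmx_entry (W : set 'rV[R]_(n + n)) s :
  smooth_on W (fun z => rsubmx z 0 s).
Proof.
have -> : (fun z : 'rV[R]_(n + n) => rsubmx z 0 s) = fun z => z 0 (rshift n s).
  by apply/funext => u; rewrite rsubmx_entry.
exact: smooth_entry.
Qed.

Lemma partial_rsubmx_entry k s z :
  partial k (fun z => rsubmx z 0 s) z = (k == rshift n s)%:R.
Proof.
have -> : (fun z : 'rV[R]_(n + n) => rsubmx z 0 s) = fun z => z 0 (rshift n s).
  by apply/funext => u; rewrite rsubmx_entry.
exact: partial_entry.
Qed.

Lemma smooth_clift f V : open V -> smooth_on V f ->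
  smooth_on (tube V) (clift f).
Proof.
move=> oV sf; have oW := tube_open oV; apply: smooth_sum => // s.
apply: smoothM => //; last exact: smooth_rsubmx_entry.
exact: (@smooth_pullback (partial s f)) (smooth_partial s sf).
Qed.

Lemma partial_clift f V z k : open V -> smooth_on V f -> V (lsubmx z) ->
  partial k (clift f) z
  = \sum_s (partial k (partial s f \o lsubmx) z * rsubmx z 0 s
            + partial s f (lsubmx z) * (k == rshift n s)%:R).
Proof.
move=> oV sf Vz; have oW := tube_open oV.
have ds s : differentiable (partial s f \o lsubmx) z.
  by have /smooth_differentiable := smooth_pullback oV (smooth_partial s sf); apply.
have dy s : differentiable (fun z : 'rV[R]_(n + n) => rsubmx z 0 s) z.
  by have /smooth_differentiable := @smooth_rsubmx_entry (tube V) s; apply.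
rewrite partial_sum => [|s]; last exact: (differentiableM (ds s) (dy s)).
apply: eq_bigr => s _.
rewrite (@partialM _ _ _ (partial s f \o lsubmx)) //.
by rewrite partial_rsubmx_entry.
Qed.

(** Lifting commutes with differentiation because second derivatives are symmetric. *)
Lemma partial_clift_l f V z i : open V -> smooth_on V f -> V (lsubmx z) ->
  partial (lshift n i) (clift f) z = clift (partial i f) z.
Proof.
move=> oV sf Vz; rewrite (partial_clift _ oV sf Vz); apply: eq_bigr => s _.
have ds := smooth_differentiable (smooth_partial s sf) Vz.
rewrite (eq_lrshift i s) mulr0 addr0 (partial_pullback_l i ds).
by rewrite (partialC i s oV sf Vz).
Qed.

Lemma partial_clift_r f V z i : open V -> smooth_on V f -> V (lsubmx z) ->
  partial (rshift n i) (clift f) z = partial i f (lsubmx z).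
Proof.
move=> oV sf Vz; rewrite (partial_clift _ oV sf Vz) (bigD1 i) //=.
have ds s := smooth_differentiable (smooth_partial s sf) Vz.
rewrite (partial_pullback_r i (ds i)) mul0r add0r eqxx mulr1 big1 ?addr0 //.
move=> s /negPf si; rewrite (partial_pullback_r i (ds s)) mul0r add0r.
by rewrite (eq_rshift n i s) eq_sym si mulr0.
Qed.

Lemma clift_eq_on f g V z : open V -> V (lsubmx z) ->
  (forall u, V u -> f u = g u) -> clift f z = clift g z.
Proof.
move=> oV Vz fg; apply: eq_bigr => s _; congr (_ * _).
exact: partial_eq_on oV Vz fg.
Qed.

Lemma clift_cst (a : R) z : clift (fun=> a) z = 0.
Proof. by rewrite /clift big1 // => s _; rewrite partial_cst mul0r. Qed.

Lemma cliftD f g z :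
  differentiable f (lsubmx z) -> differentiable g (lsubmx z) ->
  clift (fun u => f u + g u) z = clift f z + clift g z.
Proof.
move=> df dg; rewrite /clift -big_split /=; apply: eq_bigr => s _.
by rewrite partialD // mulrDl.
Qed.

Lemma cliftM f g z :
  differentiable f (lsubmx z) -> differentiable g (lsubmx z) ->
  clift (fun u => f u * g u) z
  = clift f z * g (lsubmx z) + f (lsubmx z) * clift g z.
Proof.
move=> df dg; rewrite /clift mulr_suml mulr_sumr -big_split /=.
apply: eq_bigr => s _; rewrite partialM //; ring.
Qed.

Lemma cliftN f z : differentiable f (lsubmx z) ->
  clift (fun u => - f u) z = - clift f z.
Proof.
move=> df; have -> : (fun u => - f u) = fun u => -1 * f u.
  by apply/funext => u; rewrite mulN1r.
rewrite cliftM ?clift_cst ?mul0r ?add0r ?mulN1r //.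
Qed.

Lemma clift_sum m (f : 'I_m -> 'rV[R]_n -> R) z :
  (forall k, differentiable (f k) (lsubmx z)) ->
  clift (fun u => \sum_k f k u) z = \sum_k clift (f k) z.
Proof.
move=> df; rewrite /clift exchange_big /=; apply: eq_bigr => s _.
by rewrite partial_sum // mulr_suml.
Qed.

Definition mclift p q (F : 'rV[R]_n -> 'M[R]_(p, q)) z : 'M[R]_(p, q) :=
  \matrix_(i, j) clift (fun u => F u i j) z.

Lemma mclift_eq_on p q (F G : 'rV[R]_n -> 'M[R]_(p, q)) V z :
  open V -> V (lsubmx z) -> (forall u, V u -> F u = G u) ->
  mclift F z = mclift G z.
Proof.
move=> oV Vz FG; apply/matrixP => i j; rewrite !mxE.
by apply: (clift_eq_on oV Vz) => u Vu; rewrite FG.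
Qed.

Lemma mclift_tr p q (F : 'rV[R]_n -> 'M[R]_(p, q)) z :
  mclift (fun u => (F u)^T) z = (mclift F z)^T.
Proof.
apply/matrixP => i j; rewrite !mxE.
by congr (clift _ _); apply/funext => u; rewrite mxE.
Qed.

Lemma differentiable_mulmx p q r (F : 'rV[R]_n -> 'M[R]_(p, q))
    (G : 'rV[R]_n -> 'M[R]_(q, r)) x :
  (forall i j, differentiable (fun u => F u i j) x) ->
  (forall i j, differentiable (fun u => G u i j) x) ->
  forall i j, differentiable (fun u => (F u *m G u) i j) x.
Proof.
move=> dF dG i j.
have -> : (fun u => (F u *m G u) i j)
    = \sum_k ((fun u => F u i k) * (fun u => G u k j)).
  by apply/funext => u; rewrite mxE fct_sumE.
by apply: differentiable_sum => k; exact: differentiableM.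
Qed.

Lemma mcliftM p q r (F : 'rV[R]_n -> 'M[R]_(p, q)) (G : 'rV[R]_n -> 'M[R]_(q, r))
    z :
  (forall i j, differentiable (fun u => F u i j) (lsubmx z)) ->
  (forall i j, differentiable (fun u => G u i j) (lsubmx z)) ->
  mclift (fun u => F u *m G u) z
  = mclift F z *m G (lsubmx z) + F (lsubmx z) *m mclift G z.
Proof.
move=> dF dG; apply/matrixP => i j; rewrite !mxE -big_split /=.
transitivity (clift (fun u => \sum_k F u i k * G u k j) z).
  by congr (clift _ _); apply/funext => u; rewrite mxE.
rewrite clift_sum => [|k]; last exact: (differentiableM (dF i k) (dG k j)).
apply: eq_bigr => k _; rewrite !mxE.
exact: (cliftM (dF i k) (dG k j)).
Qed.

End CompleteLift.

(** * The atlas of the tangent bundle *)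

Section TangentAtlas.
Context {R : realType} {n : nat} {M : Type} (A : atlas R n M).
Context (sA : smooth_atlas A).
Local Notation TA := (tangent_atlas A).
Implicit Types (a b : chart_ix A) (z : 'rV[R]_(n + n)).

(** Changing components from [a] to the preferred chart at the base point and then
    to [b] amounts to changing them from [a] to [b]. *)
Lemma tangent_comp_vector a b x y : overlap a b x ->
  tangent_comp b (tangent_vector a x y) = y *m 'J (transition a b) x.
Proof.
move=> abx; rewrite /tangent_comp /tangent_vector /tangent_proj /=.
set d := chart_at A (param a x).
have adx : overlap a d x.
  apply/(overlapP sA); split; first exact: (overlap_image sA abx).
  exact: (atlas_chart_at sA).
by rewrite -mulmxA -(jacobian_cocycle sA adx abx).
Qed.

Lemma tangent_coord_param a z : chart_image a (lsubmx z) ->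
  coord (a : chart_ix TA) (param (a : chart_ix TA) z) = z.
Proof.
move=> az; rewrite /= tangent_comp_vector; last exact: (overlapxx sA az).
rewrite (jacobian_transitionxx sA az) mulmx1 /tangent_proj /=.
by rewrite (paramK sA az) hsubmxK.
Qed.

Lemma tangent_image a : chart_image (a : chart_ix TA) = tube (chart_image a).
Proof.
apply/seteqP; split=> [z [w aw <-]|z az].
  by rewrite /tube /= row_mxKl; exists (tangent_proj w).
exists (param (a : chart_ix TA) z); last exact: tangent_coord_param.
exact: (chart_dom_param sA az).
Qed.

Lemma tangent_overlap a b :
  overlap (a : chart_ix TA) (b : chart_ix TA) = tube (overlap a b).
Proof.
apply/seteqP; split=> [z [w [aw bw] <-]|z abz].
  by rewrite /tube /= row_mxKl; exists (tangent_proj w).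
have [az bz] := (overlapP sA a b (lsubmx z)).1 abz.
exists (param (a : chart_ix TA) z); last exact: tangent_coord_param.
by split => //; exact: (chart_dom_param sA az).
Qed.

Lemma tangent_transitionE a b z : overlap a b (lsubmx z) ->
  transition (a : chart_ix TA) (b : chart_ix TA) z
  = row_mx (transition a b (lsubmx z))
      (rsubmx z *m 'J (transition a b) (lsubmx z)).
Proof.
move=> abz; rewrite /transition /=.
by rewrite tangent_comp_vector.
Qed.

Lemma tangent_coordK a (w : tangent_bundle A) : chart_dom a (tangent_proj w) ->
  param (a : chart_ix TA) (coord (a : chart_ix TA) w) = w.
Proof.
case: w => p v; rewrite /tangent_proj /= => ap.
rewrite /tangent_vector /= row_mxKl row_mxKr (atlas_coordK sA ap).
congr (_, _); rewrite /tangent_comp /tangent_proj /=.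
set d := chart_at A p; have dp : chart_dom d p := atlas_chart_at sA p.
have dap : overlap d a (coord d p).
  apply/(overlapP sA); rewrite (atlas_coordK sA dp); split => //.
  exact: chart_image_coord.
by rewrite -mulmxA -(transition_coord sA a dp) (jacobian_transitionK sA dap) mulmx1.
Qed.

Lemma tangent_smooth_atlas : smooth_atlas TA.
Proof.
split.
- by move=> w; exact: (atlas_chart_at sA).
- by move=> a; rewrite tangent_image; exact/tube_open/(atlas_image_open sA).
- by move=> a b; rewrite tangent_overlap; exact/tube_open/(atlas_overlap_open sA).
- exact: tangent_coordK.
- move=> a b j; rewrite tangent_overlap.
  have oab := atlas_overlap_open sA a b; have oW := tube_open oab.
  have st := atlas_transition_smooth sA a b.
  case: (split_ordP j) => i ->.
  + have := smooth_pullback oab (st i); apply: smooth_eq_on => // z abz.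
    by rewrite tangent_transitionE // row_mxEl.
  + have := smooth_clift oab (st i); apply: smooth_eq_on => // z abz.
    rewrite tangent_transitionE // row_mxEr mxE.
    apply: eq_bigr => s _; rewrite jacobianE 1?mulrC //.
    exact: (transition_differentiable sA abz).
Qed.

(** The transition map is [(x, y) |-> (phi x, y *m 'J phi x)], and the derivative of
    its second component along the base is the derivative of ['J phi] along [y]. *)
Lemma tangent_jacobian a b z : overlap a b (lsubmx z) ->
  'J (transition (a : chart_ix TA) (b : chart_ix TA)) z
  = block_mx ('J (transition a b) (lsubmx z))
      (mclift (jacobian (transition a b)) z)
      0 ('J (transition a b) (lsubmx z)).
Proof.
move=> abz.
have oab := atlas_overlap_open sA a b; have oW := tube_open oab.
have st := atlas_transition_smooth sA a b.
have dt := transition_differentiable sA abz.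
have dTt : differentiable (transition (a : chart_ix TA) (b : chart_ix TA)) z.
  by apply: (transition_differentiable tangent_smooth_atlas); rewrite tangent_overlap.
have dj i := smooth_differentiable (st i) abz.
have El k i :
    partial k (fun u =>
      transition (a : chart_ix TA) (b : chart_ix TA) u 0 (lshift n i)) z
    = partial k ((fun u => transition a b u 0 i) \o lsubmx) z.
  apply: (partial_eq_on _ oW abz) => u abu.
  by rewrite tangent_transitionE // row_mxEl.
have Er k i :
    partial k (fun u =>
      transition (a : chart_ix TA) (b : chart_ix TA) u 0 (rshift n i)) z
    = partial k (clift (fun u => transition a b u 0 i)) z.
  apply: (partial_eq_on _ oW abz) => u abu.
  rewrite tangent_transitionE // row_mxEr mxE.
  apply: eq_bigr => s _; rewrite jacobianE 1?mulrC //.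
  exact: (transition_differentiable sA abu).
apply/matrixP => k l; rewrite (jacobianE k l dTt).
case: (split_ordP k) => i ->; case: (split_ordP l) => j ->.
- by rewrite block_mxEul El partial_pullback_l // -jacobianE.
- rewrite block_mxEur Er (partial_clift_l _ oab (st j) abz) mxE.
  apply: (clift_eq_on oab abz) => u abu; rewrite jacobianE //.
  exact: (transition_differentiable sA abu).
- by rewrite block_mxEdl El partial_pullback_r // mxE.
- by rewrite block_mxEdr Er (partial_clift_r _ oab (st j) abz) -jacobianE.
Qed.

End TangentAtlas.

(** * Sums and wedge products of tensor fields *)

Section TensorOperations.
Context {R : realType} {n : nat} {T : Type} (A : atlas R n T).
Context (sA : smooth_atlas A).

Lemma wedgeE m (u v : 'rV[R]_m) i j :
  wedge u v i j = u 0 i * v 0 j - v 0 i * u 0 j.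
Proof. by rewrite !mxE !big_ord1 !mxE. Qed.

Lemma wedge_mulmx m (u v : 'rV[R]_m) (J : 'M[R]_m) :
  wedge (u *m J) (v *m J) = J^T *m wedge u v *m J.
Proof. by rewrite /wedge !trmx_mul mulmxBr mulmxBl !mulmxA. Qed.

Lemma bivector_fieldD (P Q : bivector_comp A) :
  bivector_field P -> bivector_field Q ->
  bivector_field (A := A) (fun a x => P a x + Q a x).
Proof.
move=> bP bQ; split=> [a i j|a x ax|a b x abx].
- have oa := atlas_image_open sA a.
  have := smoothD oa (bivector_smooth bP a i j) (bivector_smooth bQ a i j).
  by apply: smooth_eq_on => // u _; rewrite mxE.
- by rewrite linearD /= (bivector_skew bP ax) (bivector_skew bQ ax) opprD.
- by rewrite (bivector_compat bP abx) (bivector_compat bQ abx) mulmxDr mulmxDl.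
Qed.

Lemma wedge_bivector_field (f : T -> R) (X Y : vector_comp A) :
  smooth_function A f -> vector_field X -> vector_field Y ->
  bivector_field (A := A) (fun a x => f (param a x) *: wedge (X a x) (Y a x)).
Proof.
move=> sf vX vY; split=> [a i j|a x ax|a b x abx].
- have oa := atlas_image_open sA a.
  have sX := vector_smooth vX a; have sY := vector_smooth vY a.
  have := smoothM oa (sf a) (smoothD oa (smoothM oa (sX i) (sY j))
    (smoothN oa (smoothM oa (sY i) (sX j)))).
  by apply: smooth_eq_on => // u _; rewrite [RHS]mxE wedgeE.
- by rewrite linearZ /= -scalerN /wedge linearB /= !trmx_mul !trmxK opprB.
- rewrite (param_transition sA abx) (vector_compat vX abx) (vector_compat vY abx).
  by rewrite wedge_mulmx -scalemxAr -scalemxAl.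
Qed.

Lemma jacobian_smooth (a b : chart_ix A) i j :
  smooth_on (overlap a b) (fun x => 'J (transition a b) x i j).
Proof.
have st := smooth_partial i (atlas_transition_smooth sA a b j).
apply: smooth_eq_on st; first exact: (atlas_overlap_open sA).
by move=> u abu; rewrite jacobianE //; exact: (transition_differentiable sA).
Qed.

End TensorOperations.

(** * Lifts of tensor fields to the tangent bundle *)

Section TangentTensors.
Context {R : realType} {n : nat} {M : Type} (A : atlas R n M).
Context (sA : smooth_atlas A).
Local Notation TA := (tangent_atlas A).
Implicit Types (a b : chart_ix A) (z : 'rV[R]_(n + n)).

(** The lift of a function does not depend on the coordinates that are used. *)
Lemma clift_transition (f : 'rV[R]_n -> R) a b z : overlap a b (lsubmx z) ->
  differentiable f (transition a b (lsubmx z)) ->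
  clift f (transition (a : chart_ix TA) (b : chart_ix TA) z)
  = clift (f \o transition a b) z.
Proof.
move=> abz df; rewrite tangent_transitionE // /clift row_mxKl row_mxKr.
have dt := transition_differentiable sA abz.
under [RHS]eq_bigr do rewrite partial_comp // mulr_suml.
rewrite [RHS]exchange_big /=; apply: eq_bigr => s _.
rewrite mxE mulr_sumr; apply: eq_bigr => t _.
by rewrite jacobianE // -mulrA; congr (_ * _); rewrite mulrC.
Qed.

Lemma mclift_transition p q (F : 'rV[R]_n -> 'M[R]_(p, q)) a b z :
  overlap a b (lsubmx z) ->
  (forall i j, differentiable (fun u => F u i j) (transition a b (lsubmx z))) ->
  mclift F (transition (a : chart_ix TA) (b : chart_ix TA) z)
  = mclift (F \o transition a b) z.
Proof.
move=> abz dF; apply/matrixP => i j; rewrite mxE [RHS]mxE.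
by rewrite (clift_transition abz (dF i j)).
Qed.

Lemma ddxE (i k : 'I_n) :
  (@ddx R n i 0 (lshift n k) = (k == i)%:R) *
  (@ddx R n i 0 (rshift n k) = 0).
Proof. by rewrite /ddx row_mxEl row_mxEr !mxE eqxx. Qed.

Lemma ddyE (i k : 'I_n) :
  (@ddy R n i 0 (lshift n k) = 0) *
  (@ddy R n i 0 (rshift n k) = (k == i)%:R).
Proof. by rewrite /ddy row_mxEl row_mxEr !mxE eqxx. Qed.

Lemma sum1_delta (F : 'I_n -> R) k : \sum_i F i * (k == i)%:R = F k.
Proof.
rewrite (bigD1 k) //= eqxx mulr1 big1 ?addr0 // => i /negPf ik.
by rewrite eq_sym ik mulr0.
Qed.

Lemma complete_liftE (X : vector_comp A) a z :
  complete_lift X a z = row_mx (X a (lsubmx z)) (mclift (X a) z).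
Proof.
apply/rowP => k; rewrite mxE !summxE; case: (split_ordP k) => {}k ->.
- rewrite row_mxEl [X in _ + X]big1 => [|i _]; last first.
    by rewrite summxE big1 // => s _; rewrite mxE ddyE mulr0.
  by rewrite addr0 -[RHS]sum1_delta; apply: eq_bigr => i _; rewrite mxE ddxE.
- rewrite row_mxEr [X in X + _]big1 => [|i _]; last by rewrite mxE ddxE mulr0.
  rewrite add0r mxE -[RHS](sum1_delta (fun k => clift (fun u => X a u 0 k) z)).
  apply: eq_bigr => i _; rewrite summxE /clift mulr_suml.
  by apply: eq_bigr => s _; rewrite mxE ddyE.
Qed.

Lemma vertical_liftE (X : vector_comp A) a z :
  vertical_lift X a z = row_mx 0 (X a (lsubmx z)).
Proof.
apply/rowP => k; rewrite summxE; case: (split_ordP k) => {}k ->.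
- by rewrite row_mxEl mxE big1 // => i _; rewrite mxE ddyE mulr0.
- by rewrite row_mxEr -[RHS]sum1_delta; apply: eq_bigr => i _; rewrite mxE ddyE.
Qed.

(** The second block of the transformation law is the Leibniz rule for
    [X b \o phi = X a *m 'J phi]. *)
Lemma complete_lift_vector_field (X : vector_comp A) :
  vector_field X -> vector_field (complete_lift X).
Proof.
move=> vX; split=> [a j|a b z].
- have oa := atlas_image_open sA a; rewrite (tangent_image sA).
  have oW := tube_open oa; have sX := vector_smooth vX a.
  case: (split_ordP j) => i ->.
  + have := smooth_pullback oa (sX i); apply: smooth_eq_on => // z _.
    by rewrite complete_liftE row_mxEl.
  + have := smooth_clift oa (sX i); apply: smooth_eq_on => // z _.
    by rewrite complete_liftE row_mxEr mxE.
- rewrite (tangent_overlap sA) => abz.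
  have oab := atlas_overlap_open sA a b.
  have ax := overlap_image sA abz.
  have bx := overlap_image sA (overlap_transition sA abz).
  have dX j := smooth_differentiable (vector_smooth vX a j) ax.
  have dX' j := smooth_differentiable (vector_smooth vX b j) bx.
  rewrite !complete_liftE (mclift_transition abz) => [|i j]; last first.
    by rewrite (ord1 i); exact: dX'.
  rewrite {1}(tangent_transitionE sA abz) row_mxKl (vector_compat vX abz).
  rewrite (tangent_jacobian sA abz) mul_row_block mulmx0 addr0; congr row_mx.
  have -> : mclift (X b \o @transition _ _ _ A a b) z
      = mclift (fun u => X a u *m 'J (@transition _ _ _ A a b) u) z.
    by apply: (mclift_eq_on oab abz) => u abu; exact: (vector_compat vX abu).
  rewrite mcliftM; first by rewrite addrC.
  + by move=> i j; rewrite (ord1 i); exact: dX.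
  + move=> i j; exact: (smooth_differentiable (jacobian_smooth sA a b i j) abz).
Qed.

Lemma vertical_lift_vector_field (X : vector_comp A) :
  vector_field X -> vector_field (vertical_lift X).
Proof.
move=> vX; split=> [a j|a b z].
- have oa := atlas_image_open sA a; rewrite (tangent_image sA).
  have oW := tube_open oa; have sX := vector_smooth vX a.
  case: (split_ordP j) => i ->.
  + apply: (smooth_eq_on oW _ (smooth_cst _ 0)) => z _.
    by rewrite vertical_liftE row_mxEl mxE.
  + have := smooth_pullback oa (sX i); apply: smooth_eq_on => // z _.
    by rewrite vertical_liftE row_mxEr.
- rewrite (tangent_overlap sA) => abz.
  rewrite !vertical_liftE (tangent_transitionE sA abz) row_mxKl.
  rewrite (vector_compat vX abz) (tangent_jacobian sA abz) mul_row_block.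
  by rewrite mulmx0 !mul0mx addr0 add0r.
Qed.

Lemma sum2_delta (F : 'I_n -> 'I_n -> R) k l :
  \sum_i \sum_j F i j * ((k == i)%:R * (l == j)%:R) = F k l.
Proof.
rewrite (bigD1 k) //= (bigD1 l) //= !eqxx !mulr1.
rewrite big1 ?addr0 => [|j /negPf jl]; last by rewrite eq_sym jl !mulr0.
rewrite big1 ?addr0 // => i /negPf ik.
by rewrite big1 // => j _; rewrite eq_sym ik mul0r mulr0.
Qed.

Lemma clift_skew (P : bivector_comp A) a z i j :
  bivector_field P -> chart_image a (lsubmx z) ->
  clift (fun u => P a u j i) z = - clift (fun u => P a u i j) z.
Proof.
move=> bP az; have dP := smooth_differentiable (bivector_smooth bP a i j) az.
rewrite -(cliftN dP); apply: (clift_eq_on (atlas_image_open sA a) az) => u au.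
by have /matrixP /(_ i j) := bivector_skew bP au; rewrite !mxE.
Qed.

(** The skew-symmetry of [P] turns the lower left block [- P^T] into [P], and the
    factor 1/2 is absorbed by the two terms of each wedge product. *)
Lemma tangent_poissonE (P : bivector_comp A) a z :
  bivector_field P -> chart_image a (lsubmx z) ->
  tangent_poisson P a z
  = block_mx 0 (P a (lsubmx z)) (P a (lsubmx z)) (mclift (P a) z).
Proof.
move=> bP az; apply/matrixP => k l.
rewrite mxE [X in _ + X]mxE !summxE.
under eq_bigr do rewrite summxE.
under [X in 2^-1 * X]eq_bigr => i _.
  rewrite summxE; under eq_bigr => j _.
    rewrite summxE; under eq_bigr do rewrite mxE.
    rewrite -mulr_suml -/(clift (fun u => P a u i j) z).
    over.
  over.
under eq_bigr do under eq_bigr do rewrite mxE.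
case: (split_ordP k) => {}k ->; case: (split_ordP l) => {}l ->.
- rewrite block_mxEul mxE !big1 ?mulr0 ?addr0 // => i _; rewrite big1 // => j _;
  by rewrite wedgeE !(ddxE, ddyE) !(mulr0, mul0r) subr0 mulr0.
- rewrite block_mxEur [X in _ + 2^-1 * X]big1 => [|i _]; last first.
    by rewrite big1 // => j _; rewrite wedgeE !ddyE !(mul0r, mulr0, subr0).
  rewrite mulr0 addr0 -[RHS](sum2_delta (fun k l => P a (lsubmx z) k l)).
  do 2!apply: eq_bigr => ? _.
  by rewrite wedgeE !ddxE !ddyE mul0r subr0.
- rewrite block_mxEdl [X in _ + 2^-1 * X]big1 => [|i _]; last first.
    by rewrite big1 // => j _; rewrite wedgeE !ddyE !(mul0r, mulr0, subr0).
  have /matrixP /(_ l k) := bivector_skew bP az; rewrite !mxE => ->.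
  rewrite mulr0 addr0 -(sum2_delta (fun k l => P a (lsubmx z) k l)) -sumrN.
  apply: eq_bigr => i _; rewrite -sumrN; apply: eq_bigr => j _.
  by rewrite wedgeE !ddxE !ddyE mul0r sub0r mulrN; congr (- (_ * _)); rewrite mulrC.
- rewrite block_mxEdr big1 => [|i _]; last first.
    by rewrite big1 // => j _; rewrite wedgeE !ddxE !(mul0r, mulr0, subr0).
  rewrite add0r [RHS]mxE.
  set Q := fun i j => clift (fun u => P a u i j) z.
  transitivity (2^-1 * (Q k l - Q l k)); last first.
    by rewrite /Q (clift_skew k l bP az); field.
  congr (_ * _); rewrite -(sum2_delta Q k l) -(sum2_delta Q l k) -sumrB.
  apply: eq_bigr => i _; rewrite -sumrB; apply: eq_bigr => j _.
  rewrite wedgeE !ddyE mulrBr; congr (_ - _ * _); exact: mulrC.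
Qed.

(** The lower right block of the transformation law is the derivative along [y] of
    [P b \o phi = ('J phi)^T *m P a *m 'J phi]; the two terms in which the derivative
    falls on ['J phi] come from the off-diagonal block of the Jacobian matrix. *)
Lemma tangent_poisson_bivector_field (P : bivector_comp A) :
  bivector_field P -> bivector_field (tangent_poisson P).
Proof.
move=> bP; split=> [a i j|a z|a b z].
- have oa := atlas_image_open sA a; rewrite (tangent_image sA).
  have oW := tube_open oa; have sP := bivector_smooth bP a.
  case: (split_ordP i) => k ->; case: (split_ordP j) => l ->.
  + apply: (smooth_eq_on oW _ (smooth_cst _ 0)) => z az.
    by rewrite (tangent_poissonE bP az) block_mxEul mxE.
  + have := smooth_pullback oa (sP k l); apply: smooth_eq_on => // z az.
    by rewrite (tangent_poissonE bP az) block_mxEur.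
  + have := smooth_pullback oa (sP k l); apply: smooth_eq_on => // z az.
    by rewrite (tangent_poissonE bP az) block_mxEdl.
  + have := smooth_clift oa (sP k l); apply: smooth_eq_on => // z az.
    by rewrite (tangent_poissonE bP az) block_mxEdr mxE.
- rewrite (tangent_image sA) => az; rewrite (tangent_poissonE bP az).
  rewrite tr_block_mx trmx0 (bivector_skew bP az) opp_block_mx oppr0.
  congr block_mx; apply/matrixP => i j; rewrite [LHS]mxE [LHS]mxE !mxE.
  exact: clift_skew.
- rewrite (tangent_overlap sA) => abz.
  have oab := atlas_overlap_open sA a b.
  have ax := overlap_image sA abz.
  have bx := overlap_image sA (overlap_transition sA abz).
  have dP i j := smooth_differentiable (bivector_smooth bP a i j) ax.
  have dP' i j := smooth_differentiable (bivector_smooth bP b i j) bx.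
  have dJ i j := smooth_differentiable (jacobian_smooth sA a b i j) abz.
  have Tx : lsubmx (transition (a : chart_ix TA) (b : chart_ix TA) z)
      = @transition _ _ _ A a b (lsubmx z).
    by rewrite (tangent_transitionE sA abz) row_mxKl.
  rewrite (tangent_poissonE bP ax) tangent_poissonE //; last by rewrite Tx.
  rewrite Tx (mclift_transition abz) //.
  rewrite (tangent_jacobian sA abz) tr_block_mx trmx0 !mulmx_block.
  rewrite !(mulmx0, mul0mx, addr0, add0r) (bivector_compat bP abz).
  congr block_mx.
  pose J := jacobian (@transition _ _ _ A a b).
  have -> : mclift (P b \o @transition _ _ _ A a b) z
      = mclift (fun u => (J u)^T *m P a u *m J u) z.
    by apply: (mclift_eq_on oab abz) => u abu; exact: (bivector_compat bP abu).
  have dJT i j : differentiable (fun u => (J u)^T i j) (lsubmx z).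
    have -> : (fun u => (J u)^T i j) = fun u => J u j i.
      by apply/funext => u; rewrite mxE.
    exact: dJ.
  rewrite mcliftM //; last first.
    exact: differentiable_mulmx.
  by rewrite mcliftM // mclift_tr addrC.
Qed.

End TangentTensors.

(** * The Jacobiator of the lifted tensor *)

Section JacobiatorRules.
Context {R : realType} {n : nat}.

Lemma jacobiator_rot (P : 'rV[R]_n -> 'M[R]_n) x i j k :
  jacobiator P x i j k = jacobiator P x j k i.
Proof. by apply: eq_bigr => s _; rewrite [RHS]addrC addrA. Qed.

Lemma jacobiator_eq_on (P Q : 'rV[R]_n -> 'M[R]_n) V x i j k :
  open V -> V x -> (forall u, V u -> P u = Q u) ->
  jacobiator P x i j k = jacobiator Q x i j k.
Proof.
move=> oV Vx PQ; apply: eq_bigr => s _; rewrite (PQ x Vx).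
have E a b : partial s (fun u => P u a b) x = partial s (fun u => Q u a b) x.
  by apply: (partial_eq_on _ oV Vx) => u Vu; rewrite PQ.
by rewrite !E.
Qed.

End JacobiatorRules.

Section LiftedJacobiator.
Context {R : realType} {n : nat}.

(** The deformed tensor in the coordinates [(x, y)]; [mu] stands for [lambda * c]. *)
Definition lifted (P : 'rV[R]_n -> 'M[R]_n) (v : 'rV[R]_n -> 'rV[R]_n)
    (mu : 'rV[R]_n -> R) (z : 'rV[R]_(n + n)) : 'M[R]_(n + n) :=
  block_mx 0 (P (lsubmx z)) (P (lsubmx z)) (mclift P z)
  + mu (lsubmx z) *: wedge (row_mx (v (lsubmx z)) (mclift v z))
                           (row_mx 0 (v (lsubmx z))).

Context (V : set 'rV[R]_n) (P : 'rV[R]_n -> 'M[R]_n)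
  (v : 'rV[R]_n -> 'rV[R]_n) (mu : 'rV[R]_n -> R).
Hypotheses (oV : open V)
  (sP : forall i j, smooth_on V (fun u => P u i j))
  (sv : forall i, smooth_on V (fun u => v u 0 i))
  (smu : smooth_on V mu).
Hypothesis skewP : forall u i j, V u -> P u i j = - P u j i.
Hypothesis jacP : forall u i j k, V u -> jacobiator P u i j k = 0.
Hypothesis lieP : forall u i j, V u ->
  \sum_s (v u 0 s * partial s (fun u => P u i j) u
          - P u s j * partial s (fun u => v u 0 i) u
          - P u i s * partial s (fun u => v u 0 j) u) = 0.
Hypothesis casP : forall u i, V u -> \sum_s P u i s * partial s mu u = 0.

Let L := lifted P v mu.

Lemma lifted_ll z i j : L z (lshift n i) (lshift n j) = 0.
Proof.
rewrite mxE block_mxEul [X in X + _]mxE add0r [LHS]mxE wedgeE !row_mxEl.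
by rewrite !mxE mulr0 mul0r subr0 mulr0.
Qed.

Lemma lifted_lr z i j : L z (lshift n i) (rshift n j)
  = P (lsubmx z) i j + mu (lsubmx z) * (v (lsubmx z) 0 i * v (lsubmx z) 0 j).
Proof.
rewrite mxE block_mxEur [X in _ + X]mxE wedgeE !row_mxEl !row_mxEr.
by rewrite [X in _ - X * _]mxE mul0r subr0.
Qed.

Lemma lifted_rl z i j : L z (rshift n i) (lshift n j)
  = P (lsubmx z) i j - mu (lsubmx z) * (v (lsubmx z) 0 i * v (lsubmx z) 0 j).
Proof.
rewrite mxE block_mxEdl [X in _ + X]mxE wedgeE !row_mxEl !row_mxEr.
by rewrite [X in _ * X - _]mxE mulr0 sub0r mulrN.
Qed.

Lemma lifted_rr z i j : L z (rshift n i) (rshift n j)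
  = clift (fun u => P u i j) z
    + mu (lsubmx z) * (clift (fun u => v u 0 i) z * v (lsubmx z) 0 j
                       - v (lsubmx z) 0 i * clift (fun u => v u 0 j) z).
Proof.
by rewrite mxE block_mxEdr mxE [X in _ + X]mxE wedgeE !row_mxEr !mxE.
Qed.

Section Point.
Context (z : 'rV[R]_(n + n)) (Vz : V (lsubmx z)).
Let x := lsubmx z.

(* At x the letters p, y, m denote the values of P, v, mu, and dP, dv, dm their
   partial derivatives; q, w, eP, ev are the derivatives along the fibre
   coordinate of P, v and of their partial derivatives. *)
Let p i j := P x i j.
Let q i j := clift (fun u => P u i j) z.
Let dP s i j := partial s (fun u => P u i j) x.
Let eP s i j := clift (partial s (fun u => P u i j)) z.
Let w i := clift (fun u => v u 0 i) z.
Let dv s i := partial s (fun u => v u 0 i) x.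
Let ev s i := clift (partial s (fun u => v u 0 i)) z.
Let m := mu x.
Let dm s := partial s mu x.
Let y i := v x 0 i.

Let dfP i j : differentiable (fun u => P u i j) x.
Proof. exact: smooth_differentiable (sP i j) Vz. Qed.
Let dfdP s i j : differentiable (partial s (fun u => P u i j)) x.
Proof. exact: smooth_differentiable (smooth_partial s (sP i j)) Vz. Qed.
Let dfv i : differentiable (fun u => v u 0 i) x.
Proof. exact: smooth_differentiable (sv i) Vz. Qed.
Let dfdv s i : differentiable (partial s (fun u => v u 0 i)) x.
Proof. exact: smooth_differentiable (smooth_partial s (sv i)) Vz. Qed.
Let dfm : differentiable mu x.
Proof. exact: smooth_differentiable smu Vz. Qed.

Let dW (f : 'rV[R]_(n + n) -> R) : smooth_on (tube V) f -> differentiable f z.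
Proof. by move=> sf; exact: smooth_differentiable sf Vz. Qed.

Lemma partial_lifted_ll k i j :
  partial k (fun u => L u (lshift n i) (lshift n j)) z = 0.
Proof.
have -> : (fun u => L u (lshift n i) (lshift n j)) = fun=> 0.
  by apply/funext => u; exact: lifted_ll.
exact: partial_cst.
Qed.

Let sxy i j : smooth_on V (fun u => mu u * (v u 0 i * v u 0 j)).
Proof. by apply: smoothM => //; exact: smoothM. Qed.

Let partial_mvv s i j : partial s (fun u => mu u * (v u 0 i * v u 0 j)) x
  = dm s * (y i * y j) + m * (dv s i * y j + y i * dv s j).
Proof. by rewrite partialM ?partialM //; exact: differentiableM. Qed.

Let Elr i j : (fun u => L u (lshift n i) (rshift n j))
  = (fun u => P u i j + mu u * (v u 0 i * v u 0 j)) \o lsubmx.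
Proof. by apply/funext => u; exact: lifted_lr. Qed.

Let Erl i j : (fun u => L u (rshift n i) (lshift n j))
  = (fun u => P u i j + - (mu u * (v u 0 i * v u 0 j))) \o lsubmx.
Proof. by apply/funext => u; exact: lifted_rl. Qed.

Lemma partial_lifted_lr_l s i j :
  partial (lshift n s) (fun u => L u (lshift n i) (rshift n j)) z
  = dP s i j + (dm s * (y i * y j) + m * (dv s i * y j + y i * dv s j)).
Proof.
have dxy := smooth_differentiable (sxy i j) Vz.
rewrite Elr partial_pullback_l; last exact: differentiableD.
by rewrite partialD // partial_mvv.
Qed.

Lemma partial_lifted_lr_r s i j :
  partial (rshift n s) (fun u => L u (lshift n i) (rshift n j)) z = 0.
Proof.
have dxy := smooth_differentiable (sxy i j) Vz.
by rewrite Elr partial_pullback_r //; exact: differentiableD.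
Qed.

Lemma partial_lifted_rl_l s i j :
  partial (lshift n s) (fun u => L u (rshift n i) (lshift n j)) z
  = dP s i j - (dm s * (y i * y j) + m * (dv s i * y j + y i * dv s j)).
Proof.
have dxy := smooth_differentiable (sxy i j) Vz.
have dNxy := smooth_differentiable (smoothN oV (sxy i j)) Vz.
rewrite Erl partial_pullback_l; last exact: differentiableD.
rewrite partialD // -partial_mvv; congr (_ + _).
by rewrite /partial deriveN //; exact: diff_derivable.
Qed.

Lemma partial_lifted_rl_r s i j :
  partial (rshift n s) (fun u => L u (rshift n i) (lshift n j)) z = 0.
Proof.
have dNxy := smooth_differentiable (smoothN oV (sxy i j)) Vz.
by rewrite Erl partial_pullback_r //; exact: differentiableD.
Qed.

Lemma partial_lifted_rr k i j :
  partial k (fun u => L u (rshift n i) (rshift n j)) z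
  = partial k (clift (fun u => P u i j)) z
    + (partial k (mu \o lsubmx) z * (w i * y j - y i * w j)
       + m * (partial k (clift (fun u => v u 0 i)) z * y j
              + w i * partial k ((fun u => v u 0 j) \o lsubmx) z
              - (partial k ((fun u => v u 0 i) \o lsubmx) z * w j
                 + y i * partial k (clift (fun u => v u 0 j)) z))).
Proof.
pose Y i := (fun u => v u 0 i) \o (lsubmx : 'rV[R]_(n + n) -> 'rV[R]_n).
pose W i := clift (fun u => v u 0 i).
pose mm := mu \o (lsubmx : 'rV[R]_(n + n) -> 'rV[R]_n).
have -> : (fun u => L u (rshift n i) (rshift n j))
    = (fun u => clift (fun u => P u i j) u
                + mm u * (W i u * Y j u + -1 * (Y i u * W j u))).
  by apply/funext => u; rewrite mulN1r; exact: lifted_rr.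
have dmm : differentiable mm z by exact/dW/smooth_pullback.
have dY k' : differentiable (Y k') z by exact/dW/(smooth_pullback oV (sv k')).
have dWW k' : differentiable (W k') z by exact/dW/(smooth_clift oV (sv k')).
have dPP : differentiable (clift (fun u => P u i j)) z.
  exact/dW/(smooth_clift oV (sP i j)).
have d1 : differentiable (fun u => W i u * Y j u) z by exact: differentiableM.
have d2 : differentiable (fun u => Y i u * W j u) z by exact: differentiableM.
have dcst : differentiable (fun=> -1 : R) z by exact: differentiable_cst.
have d3 : differentiable (fun u => -1 * (Y i u * W j u)) z.
  exact: differentiableM.
have d4 : differentiable (fun u => W i u * Y j u + -1 * (Y i u * W j u)) z.
  exact: differentiableD.
rewrite (partialD k dPP (differentiableM dmm d4)) (partialM k dmm d4).
rewrite (partialD k d1 d3) (partialM k (dWW i) (dY j)) (partialM k dcst d2).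
by rewrite (partialM k (dY i) (dWW j)) partial_cst mul0r add0r !mulN1r.
Qed.

Lemma partial_lifted_rr_l s i j :
  partial (lshift n s) (fun u => L u (rshift n i) (rshift n j)) z
  = eP s i j + (dm s * (w i * y j - y i * w j)
      + m * (ev s i * y j + w i * dv s j - (dv s i * w j + y i * ev s j))).
Proof.
rewrite partial_lifted_rr (partial_clift_l s oV (sP i j) Vz).
rewrite (partial_clift_l s oV (sv i) Vz) (partial_clift_l s oV (sv j) Vz).
by rewrite !partial_pullback_l.
Qed.

Lemma partial_lifted_rr_r s i j :
  partial (rshift n s) (fun u => L u (rshift n i) (rshift n j)) z
  = dP s i j + m * (dv s i * y j - y i * dv s j).
Proof.
rewrite partial_lifted_rr (partial_clift_r s oV (sP i j) Vz).
rewrite (partial_clift_r s oV (sv i) Vz) (partial_clift_r s oV (sv j) Vz).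
by rewrite !partial_pullback_r // !(mul0r, mulr0, add0r, addr0).
Qed.

Let jac0 i j k : \sum_s (p i s * dP s j k + p j s * dP s k i + p k s * dP s i j) = 0.
Proof. exact: jacP. Qed.

Let lie0 i j : \sum_s (y s * dP s i j + p j s * dv s i - p i s * dv s j) = 0.
Proof.
rewrite -[RHS](lieP i j Vz); apply: eq_bigr => s _.
by rewrite (skewP s j Vz) mulNr opprK.
Qed.

Let cas0 i : \sum_s p i s * dm s = 0.
Proof. exact: casP. Qed.

Let jac1 i j k : \sum_s ((q i s * dP s j k + p i s * eP s j k)
  + (q j s * dP s k i + p j s * eP s k i)
  + (q k s * dP s i j + p k s * eP s i j)) = 0.
Proof.
have E : clift (fun u => \sum_s (P u i s * partial s (fun u => P u j k) u
    + P u j s * partial s (fun u => P u k i) u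
    + P u k s * partial s (fun u => P u i j) u)) z = 0.
  rewrite (clift_eq_on (g := fun=> 0) oV Vz) ?clift_cst // => u Vu.
  exact: (jacP i j k Vu).
have dM s a b c := differentiableM (dfP a s) (dfdP s b c).
have dD s := differentiableD (dM s i j k) (dM s j k i).
rewrite -[RHS]E clift_sum => [|s]; last exact: differentiableD (dD s) (dM s k i j).
apply: eq_bigr => s _; rewrite (cliftD (dD s) (dM s k i j)).
rewrite (cliftD (dM s i j k) (dM s j k i)) (cliftM (dfP i s) (dfdP s j k)).
by rewrite (cliftM (dfP j s) (dfdP s k i)) (cliftM (dfP k s) (dfdP s i j)).
Qed.

Let lie1 i j : \sum_s (w s * dP s i j + y s * eP s i j
  + (q j s * dv s i + p j s * ev s i) - (q i s * dv s j + p i s * ev s j)) = 0.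
Proof.
have E : clift (fun u => \sum_s (v u 0 s * partial s (fun u => P u i j) u
    + P u j s * partial s (fun u => v u 0 i) u
    + -1 * (P u i s * partial s (fun u => v u 0 j) u))) z = 0.
  rewrite (clift_eq_on (g := fun=> 0) oV Vz) ?clift_cst // => u Vu.
  rewrite -[RHS](lieP i j Vu); apply: eq_bigr => s _.
  by rewrite mulN1r (skewP s j Vu) mulNr opprK.
have d1 s := differentiableM (dfv s) (dfdP s i j).
have d2 s a b := differentiableM (dfP a s) (dfdv s b).
have d3 s a b : differentiable (fun u => -1 * (P u a s * partial s (fun u => v u 0 b) u)) x.
  by apply: differentiableM; [exact: differentiable_cst|exact: d2].
have d4 s := differentiableD (d1 s) (d2 s j i).
rewrite -[RHS]E clift_sum => [|s]; last exact: differentiableD (d4 s) (d3 s i j).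
apply: eq_bigr => s _; rewrite (cliftD (d4 s) (d3 s i j)) (cliftD (d1 s) (d2 s j i)).
rewrite (cliftM (dfv s) (dfdP s i j)) (cliftM (dfP j s) (dfdv s i)).
rewrite cliftM; [|exact: differentiable_cst|exact: d2].
by rewrite (cliftM (dfP i s) (dfdv s j)) clift_cst mul0r add0r mulN1r.
Qed.

(** Of the four types of components, with no, one, two or three fibre indices, only
    the last two involve the equations satisfied by [P], [v] and [mu]. Here the
    Jacobiator is that of [P] plus multiples of the Lie derivative of [P] along
    [v] and of the Hamiltonian field of [mu], all of which vanish. *)
Lemma jacobiator_lifted_lrr i j k :
  jacobiator L z (lshift n i) (rshift n j) (rshift n k) = 0.
Proof.
rewrite /jacobiator big_split_ord /= -big_split /=.
(* The identity holds for each s: the derivatives of v in the three Lie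
   derivatives are exactly those in the derivatives of the blocks. *)
transitivity (\sum_s ((p i s * dP s j k + p j s * dP s k i + p k s * dP s i j)
  + m * y i * (y s * dP s j k + p k s * dv s j - p j s * dv s k)
  - m * y j * (y s * dP s k i + p i s * dv s k - p k s * dv s i)
  - m * y k * (y s * dP s i j + p j s * dv s i - p i s * dv s j)
  - y k * y i * (p j s * dm s) + y i * y j * (p k s * dm s))); last first.
  rewrite big_split /= sumrB sumrB sumrB big_split /= -!mulr_sumr.
  by rewrite jac0 !lie0 !cas0 !mulr0 !subr0 !addr0.
apply: eq_bigr => s _.
rewrite partial_lifted_rl_l partial_lifted_lr_l partial_lifted_rr_r.
rewrite partial_lifted_lr_r partial_lifted_rl_r.
rewrite lifted_ll lifted_lr !lifted_rl !mulr0 mul0r.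
rewrite -/x -/m -!/(p _ _) -!/(y _).
move: (p i s) (p j s) (p k s) (dP s j k) (dP s k i) (dP s i j) (y i) (y j) (y k)
  (y s) (dv s i) (dv s j) (dv s k) m (dm s) => *; ring.
Qed.

(** The same equations enter, together with their derivatives along the fibre
    coordinate; the terms of second order in [mu] cancel in the cyclic sum. *)
Lemma jacobiator_lifted_rrr i j k :
  jacobiator L z (rshift n i) (rshift n j) (rshift n k) = 0.
Proof.
rewrite /jacobiator big_split_ord /= -big_split /=.
pose X i j s := y s * dP s i j + p j s * dv s i - p i s * dv s j.
pose X1 i j s := w s * dP s i j + y s * eP s i j
  + (q j s * dv s i + p j s * ev s i) - (q i s * dv s j + p i s * ev s j).
have X0 a b : \sum_s X a b s = 0 by exact: lie0.
have X10 a b : \sum_s X1 a b s = 0 by exact: lie1.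
(* X and X1 are the summands of the Lie derivative and of its derivative along
   the fibre coordinate; again the identity holds for each s. *)
transitivity (\sum_s (((q i s * dP s j k + p i s * eP s j k)
     + (q j s * dP s k i + p j s * eP s k i)
     + (q k s * dP s i j + p k s * eP s i j))
  + (m * w i * X j k s + m * w j * X k i s + m * w k * X i j s)
  - (m * y i * X1 j k s + m * y j * X1 k i s + m * y k * X1 i j s)
  + ((w j * y k - y j * w k) * (p i s * dm s)
     + (w k * y i - y k * w i) * (p j s * dm s)
     + (w i * y j - y i * w j) * (p k s * dm s)))); last first.
  rewrite big_split /= sumrB big_split /= jac1.
  clearbody X X1; rewrite !big_split /= -!mulr_sumr !cas0.
  by rewrite !X0 !X10 !mulr0 !addr0 subr0.
apply: eq_bigr => s _; rewrite /X /X1.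
rewrite !partial_lifted_rr_l !partial_lifted_rr_r !lifted_rl !lifted_rr.
rewrite -/x -/m -!/(p _ _) -!/(y _) -!/(w _) -!/(q _ _).
move: (p i s) (p j s) (p k s) (dP s j k) (dP s k i) (dP s i j) (y i) (y j) (y k)
  (y s) (dv s i) (dv s j) (dv s k) m (dm s).
move: (q i s) (q j s) (q k s) (eP s j k) (eP s k i) (eP s i j) (w i) (w j) (w k)
  (w s) (ev s i) (ev s j) (ev s k) => *; ring.
Qed.

Lemma jacobiator_lifted_lll i j k :
  jacobiator L z (lshift n i) (lshift n j) (lshift n k) = 0.
Proof.
by rewrite /jacobiator big1 // => s _; rewrite !partial_lifted_ll !mulr0 !addr0.
Qed.

Lemma jacobiator_lifted_llr i j k :
  jacobiator L z (lshift n i) (lshift n j) (rshift n k) = 0.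
Proof.
rewrite /jacobiator big_split_ord /= -[RHS](addr0 (0 : R)); congr (_ + _).
- rewrite big1 // => s _.
  by rewrite partial_lifted_ll !lifted_ll !mul0r mulr0 !addr0.
- rewrite big1 // => s _.
  by rewrite partial_lifted_ll partial_lifted_lr_r partial_lifted_rl_r !mulr0 !addr0.
Qed.

Lemma jacobiator_lifted I J K : jacobiator L z I J K = 0.
Proof.
case: (split_ordP I) => i ->; case: (split_ordP J) => j ->;
  case: (split_ordP K) => k ->.
- exact: jacobiator_lifted_lll.
- exact: jacobiator_lifted_llr.
- by rewrite 2!jacobiator_rot jacobiator_lifted_llr.
- exact: jacobiator_lifted_lrr.
- by rewrite jacobiator_rot jacobiator_lifted_llr.
- by rewrite jacobiator_rot jacobiator_lifted_lrr.
- by rewrite 2!jacobiator_rot jacobiator_lifted_lrr.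
- exact: jacobiator_lifted_rrr.
Qed.

End Point.
End LiftedJacobiator.

(** * Deformation of the lifted Poisson tensor *)

Theorem theorem4 (R : realType) (N : nat) (M : topologicalType)
    (A : atlas R N M) (manifold_M : smooth_manifold A)
    (Pi : bivector_comp A) (poisson_Pi : poisson_tensor Pi)
    (c : M -> R) (casimir_c : casimir Pi c) (lambda : R)
    (X : vector_comp A) (poisson_X : poisson_vector_field Pi X) :
  @poisson_tensor R (N + N) (tangent_bundle A) (tangent_atlas A)
    (fun (a : chart_ix (tangent_atlas A)) (z : 'rV[R]_(N + N)) =>
       tangent_poisson Pi a z
       + (lambda * c (tangent_proj (param a z)))
           *: wedge (complete_lift X a z) (vertical_lift X a z)).
Proof.
have sA := manifold_atlas manifold_M; have sTA := tangent_smooth_atlas sA.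
have [bPi _] := poisson_Pi; have [vX lieX] := poisson_X; have [sc _] := casimir_c.
have jPi := jacobiator_eq0 manifold_M poisson_Pi.
have cPi := casimir_in_chart manifold_M bPi casimir_c.
have sf : smooth_function (tangent_atlas A)
    (fun w => lambda * c (tangent_proj w)).
  move=> a; rewrite (tangent_image sA); have oa := atlas_image_open sA a.
  apply: smoothM; [exact: tube_open|exact: smooth_cst|].
  exact: (smooth_pullback oa (sc a)).
have bT : bivector_field (A := tangent_atlas A)
    (fun a z => tangent_poisson Pi a z
       + (lambda * c (tangent_proj (param a z)))
           *: wedge (complete_lift X a z) (vertical_lift X a z)).
  apply: (bivector_fieldD sTA); first exact: tangent_poisson_bivector_field.
  apply: (wedge_bivector_field sTA sf).
    exact: complete_lift_vector_field.
  exact: vertical_lift_vector_field.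
apply: (poisson_of_jacobiator sTA bT) => a z.
rewrite (tangent_image sA) => az I J K; have oa := atlas_image_open sA a.
pose mu u := lambda * c (@param _ _ _ A a u).
rewrite (jacobiator_eq_on (Q := lifted (Pi a) (X a) mu) _ _ _ (tube_open oa) az).
  have smu : smooth_on (chart_image (a : chart_ix A)) mu.
    exact: (smoothM oa (smooth_cst _ lambda) (sc a)).
  apply: (jacobiator_lifted oa) => //.
  - exact: (bivector_smooth bPi).
  - exact: (vector_smooth vX).
  - move=> u i j au; have /matrixP /(_ j i) := bivector_skew bPi au.
    by rewrite !mxE.
  - by move=> u i j k au; exact: jPi.
  - by move=> u i j au; have /matrixP /(_ i j) := lieX a u au; rewrite !mxE.
  - move=> u i au.
    transitivity (lambda * \sum_s Pi a u i s * partial s (c \o @param _ _ _ A a) u);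
      last by rewrite (cPi a u au) mulr0.
    rewrite mulr_sumr; apply: eq_bigr => s _.
    have dl : differentiable (fun=> lambda) u by exact: differentiable_cst.
    rewrite (partialM s dl (smooth_differentiable (sc a) au)).
    by rewrite partial_cst mul0r add0r mulrCA.
by move=> u au; rewrite (tangent_poissonE sA bPi au) complete_liftE vertical_liftE.
Qed.
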